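(* Consider the elephant random walk $(S_n)$ with two memory channels and memory parameter $p\in(0,1)$. The walk is recurrent if and only if $$p\le\frac{11}{16}.$$ Equivalently, it is transient if and only if $p>11/16$.
   Context: Model (elephant random walk with two memory channels, memory parameter $p\in(0,1)$): $S_0=0$; $X_1,X_2$ are independent random signs, each equal to $1$ or $-1$ with probability $1/2$. For $n\ge2$ choose, independently of the past and independently for different $n$, indices $U_{1,n+1},U_{2,n+1}$ i.i.d. uniform on $\{1,\ldots,n\}$ and signs $\sigma_{1,n+1},\sigma_{2,n+1}\in\{-1,1\}$, independent of each other and of the indices, with $\mathbb{P}(\sigma_{i,n+1}=1)=p$, $\mathbb{P}(\sigma_{i,n+1}=-1)=1-p$. Put $Y_{i,n+1}=\sigma_{i,n+1}X_{U_{i,n+1}}$ for $i=1,2$, and $X_{n+1}=\operatorname{sgn}(Y_{1,n+1}+Y_{2,n+1})$ with $\operatorname{sgn}(0)=0$. The position is $S_n=\sum_{j=1}^nX_j$. Recurrent means that almost surely $S_n=0$ for infinitely many $n$; transient means that almost surely $S_n=0$ for only finitely many $n$. *)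

(* Defs.v *)
From HB Require Import structures.
From mathcomp Require Import all_boot all_order all_algebra.
From mathcomp Require Import all_classical all_reals all_analysis.

Set Implicit Arguments.
Unset Strict Implicit.
Unset Printing Implicit Defensive.

Import Order.TTheory GRing.Theory Num.Theory.

Local Open Scope classical_set_scope.
Local Open Scope ring_scope.

(* Mutual independence of the set systems F i, for i in the index set A. *)
Definition mutually_independent (R : realType) (d : measure_display)
    (T : measurableType d) (P : probability T R) (I : eqType) (A : set I)
    (F : I -> set (set T)) : Prop :=
  forall (s : seq I) (E : I -> set T), uniq s ->
    (forall i, i \in s -> A i /\ F i (E i)) ->
    P (\bigcap_(i in [set` s]) E i) = (\prod_(i <- s) P (E i))%E.

(* Labels of the independent sources of randomness: [inl j] is the step X_j,
   [inr (inl (i, m))] is the index U_{i,m}, and [inr (inr (i, m))] is the sign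
   sigma_{i,m}.  Channels i = 1, 2 are numbered by 'I_2. *)
Definition source : eqType := (nat + ('I_2 * nat + 'I_2 * nat))%type.

(* The labels in use: X_1, X_2, and U_{i,n+1}, sigma_{i,n+1} for n >= 2. *)
Definition active : set source := [set l |
  match l with
  | inl j => (1 <= j <= 2)%N
  | inr (inl (_, m)) | inr (inr (_, m)) => (3 <= m)%N
  end].

Definition source_algebra (R : realType) (d : measure_display)
    (T : measurableType d) (P : probability T R) (X : nat -> {RV P >-> R})
    (U : 'I_2 -> nat -> {RV P >-> nat}) (sigma : 'I_2 -> nat -> {RV P >-> R})
    (l : source) : set (set T) :=
  match l with
  | inl j => g_sigma_algebra_preimage (X j)
  | inr (inl (i, m)) => g_sigma_algebra_preimage (U i m)
  | inr (inr (i, m)) => g_sigma_algebra_preimage (sigma i m)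
  end.

(* X 0, and U i m, sigma i m for m <= 2, are unconstrained and play no role. *)
Record two_channel_erw (R : realType) (d : measure_display)
    (T : measurableType d) (P : probability T R) (p : R)
    (X : nat -> {RV P >-> R}) (U : 'I_2 -> nat -> {RV P >-> nat})
    (sigma : 'I_2 -> nat -> {RV P >-> R}) : Prop := {
  erw_initial : forall j, (1 <= j <= 2)%N ->
    P (X j @^-1` [set 1]) = (2^-1)%:E /\ P (X j @^-1` [set -1]) = (2^-1)%:E ;
  erw_index : forall (i : 'I_2) (n k : nat), (2 <= n)%N -> (1 <= k <= n)%N ->
    P (U i n.+1 @^-1` [set k]) = (n%:R^-1)%:E ;
  erw_sign : forall (i : 'I_2) (n : nat), (2 <= n)%N ->
    P (sigma i n.+1 @^-1` [set 1]) = p%:E /\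
    P (sigma i n.+1 @^-1` [set -1]) = (1 - p)%:E ;
  erw_independent : mutually_independent P active (source_algebra X U sigma) ;
  erw_step : forall (n : nat) (w : T), (2 <= n)%N ->
    X n.+1 w = Num.sg (\sum_(i < 2) sigma i n.+1 w * X (U i n.+1 w) w)
}.

Definition position (R : realType) (d : measure_display)
    (T : measurableType d) (P : probability T R) (X : nat -> {RV P >-> R})
    (n : nat) (w : T) : R :=
  \sum_(1 <= j < n.+1) X j w.

Definition recurrent (R : realType) (d : measure_display)
    (T : measurableType d) (P : probability T R)
    (X : nat -> {RV P >-> R}) : Prop :=
  \forall w \ae P, infinite_set [set n | position X n w = 0].

Definition transient (R : realType) (d : measure_display)
    (T : measurableType d) (P : probability T R)
    (X : nat -> {RV P >-> R}) : Prop :=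
  \forall w \ae P, finite_set [set n | position X n w = 0].

(* Main.v *)
Require Import Defs.
From mathcomp Require Import all_boot all_order all_algebra.
From mathcomp Require Import all_classical all_reals all_analysis.
From mathcomp Require Import ring lra zify.

Set Implicit Arguments.
Unset Strict Implicit.
Unset Printing Implicit Defensive.

Import Order.TTheory GRing.Theory Num.Theory.

Local Open Scope ring_scope.

(** Write [s] for the position at time [n], [k] for the number of nonzero steps
taken so far and [beta = 2 * p - 1]. Given the past, the next step has mean
[beta * (2 - k / n) * s / n], and it is nonzero with probability about
[k / n * (2 - 3 / 2 * (k / n))]. The density [k / n] is therefore attracted by
[2 / 3], where the drift of the position becomes [4 / 3 * beta * s / n]. As for
every process with drift [alpha * s / n] and bounded noise, the noise wins for
[alpha <= 1 / 2] and the drift wins for [alpha > 1 / 2]; the critical value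
[alpha = 1 / 2] is [beta = 3 / 8], that is [p = 11 / 16]. Both regimes are
proved with Lyapunov functions of [(n, s, k)] in which the fluctuations of the
density cancel, so that no convergence of [k / n] is ever needed; the only
information on the density is that [n / k] has expectation at most [3]
([expect_inverse_density]).

For [p <= 11 / 16], the quantity [M = |s| / (k * n) ^ (1 / 4)] is a positive
supermartingale until the walk hits the origin, because the contributions of
[k / n] to the drifts of [s] and of [(k * n) ^ (1 / 4)] compensate each other
([recurrent_drift]). The concave function [M / (1 + M)] then loses at time [n] at
least a constant times [(k / n) / (1 + M) ^ 3 / n]. If the walk avoided the
origin with positive probability, then, [M] and [n / k] being bounded in mean,
these losses would dominate a multiple of the harmonic series, although their sum
is at most [1] ([recurrent_avoids]).

For [p > 11 / 16], let [w = s ^ 2 / (2 * n + 3 * k)]. For [c] large the function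
[V = 1 / (c + w)], corrected by a summable term of order [1 / n], is a
supermartingale ([transient_drift]). It is at least [1 / c] at the origin, so that
the probability of a visit to the origin after time [m] is at most [c] times its
expectation at time [m] ([hit_le_potential]). Its decrease at time [n] is at least
a constant times [(k / n) * V ^ 2 / n], and the divergence of the harmonic series
forces its expectation to [0] ([potential_small]).

The estimates are carried out for a functional [expect] given by finite sums over
the choices of the two channels. It is the law of the walk: this follows by
induction on time from the independence of the sources, by splitting the
probability space along the four sources used at each step ([trajectory_law]). *)

(** * Step probabilities and the density of moves *)

Section StepProbability.
Context {R : realFieldType}.
Implicit Types beta n s k : R.

(** With [k] nonzero steps of sum [s] among the first [n], a channel reports [1]
with probability [a] and [0] with probability [1 - k / n]. The new step is [1] if
both channels report [1], or one reports [1] and the other [0]. Exchanging the two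
signs, [up_prob beta n (- s) k] is the probability of a step [-1]. *)
Definition up_prob beta n s k : R :=
  let a := (k + beta * s) / (2 * n) in a * (a + 2 * (1 - k / n)).

Lemma up_prob_drift beta n s k : 0 < n ->
  up_prob beta n s k - up_prob beta n (- s) k = beta * (2 - k / n) * s / n.
Proof. by move=> n0; rewrite /up_prob /=; field; rewrite ?gt_eqF. Qed.

Lemma up_prob_move beta n s k : 0 < n ->
  up_prob beta n s k + up_prob beta n (- s) k =
  k / n * (2 - 3 / 2 * (k / n)) + (beta * s / n) ^+ 2 / 2.
Proof. by move=> n0; rewrite /up_prob /=; field; rewrite ?gt_eqF. Qed.

(** Here [e] is a lower bound for both [p] and [1 - p]. The probability that both
channels report [1] is only quadratic in [k / n], but for small [k / n] one report
suffices, the other channel being silent. *)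
Lemma up_prob_ge beta e n s k : 0 <= e -> 2 * e - 1 <= beta <= 1 - 2 * e ->
  0 < n -> `|s| <= k -> k <= n -> e ^+ 2 * (k / n) <= up_prob beta n s k.
Proof.
move=> e0 /andP[b1 b2] n0 sk kn.
have k0 : 0 <= k by apply: le_trans sk.
have /andP[s1 s2] : - k <= s <= k by rewrite -ler_norml.
rewrite /up_prob /=; set x := k / n; set a := _ / (2 * n).
have x1 : x <= 1 by rewrite ler_pdivrMr// mul1r.
have x0 : 0 <= x by rewrite divr_ge0// ltW.
have ax : e * x <= a.
  rewrite /a /x mulrA ler_pdivrMr// [_ / _ * n](_ : _ = (k + beta * s) / 2); last first.
    by field; rewrite gt_eqF.
  by nra.
have e12 : e <= 1 / 2 by lra.
have ex0 : 0 <= e * x by rewrite mulr_ge0.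
have : e * x * (e * x + 2 * (1 - x)) <= a * (a + 2 * (1 - x)) by apply: ler_pM => //; lra.
apply: le_trans.
(* this is (2 - e) * (1 - x) >= 0: a channel that rarely reports a move makes
   up for it by staying silent *)
have : e <= e * x + 2 * (1 - x) by nra.
nra.
Qed.

Lemma up_prob_ge0 beta n s k : -1 <= beta <= 1 -> 0 < n -> `|s| <= k -> k <= n ->
  0 <= up_prob beta n s k.
Proof.
move=> /andP[b1 b2] n0 sk kn; have := @up_prob_ge beta 0 n s k.
rewrite expr0n mul0r; apply => //; lra.
Qed.

Lemma up_prob_move_le1 beta n s k : -1 <= beta <= 1 -> 0 < n -> `|s| <= k -> k <= n ->
  up_prob beta n s k + up_prob beta n (- s) k <= 1.
Proof.
move=> /andP[b1 b2] n0 sk kn.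
have /andP[s1 s2] : - k <= s <= k by rewrite -ler_norml.
have k0 : 0 <= k by apply: le_trans sk.
rewrite up_prob_move//.
set x := k / n; have x1 : x <= 1 by rewrite ler_pdivrMr// mul1r.
have x0 : 0 <= x by rewrite divr_ge0// ltW.
have : (beta * s / n) ^+ 2 <= x ^+ 2.
  have bsk : `|beta * s / n| <= x.
    rewrite normrM [X in _ * X]gtr0_norm ?invr_gt0// ler_pM2r ?invr_gt0//.
    by rewrite normrM (le_trans _ sk)// ler_piMl// ler_norml b1.
  by rewrite -[leLHS]real_normK ?num_real// lerXn2r ?nnegrE.
nra.
Qed.

(** The density [k / n] stays constant if a move has probability [k / n], and it
is almost [2 * (k / n)] when the density is small: a large [n / k] is pulled back.
The loss of a factor [k / (k + 1)] in the decrease of [1 / k] is harmless since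
this factor is at least [2 / 3], by [2 <= k]. *)
Lemma inverse_density_drift beta n s k :
  let q := up_prob beta n s k + up_prob beta n (- s) k in
  2 <= n -> 2 <= k -> k <= n ->
  q * ((n + 1) / (k + 1)) + (1 - q) * ((n + 1) / k) <=
  (1 - 1 / (3 * n)) * (n / k) + 1 / n.
Proof.
move=> q n2 k2 kn.
have n0 : 0 < n by lra.
have k0 : 0 < k by lra.
set x := k / n; have x1 : x <= 1 by rewrite ler_pdivrMr// mul1r.
have x0 : 0 < x by rewrite divr_gt0.
have qx : x * (2 - 3 / 2 * x) <= q.
  by rewrite /q up_prob_move// lerDl divr_ge0 ?sqr_ge0.
have h : 2 / 3 <= k / (k + 1) by rewrite ler_pdivlMr; lra.
have -> : q * ((n + 1) / (k + 1)) + (1 - q) * ((n + 1) / k) =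
    (n + 1) / k - q * (k / (k + 1)) * ((n + 1) / k ^+ 2).
  by field; rewrite !gt_eqF//; lra.
have : x * (2 - 3 / 2 * x) * (2 / 3) <= q * (k / (k + 1)) by apply: ler_pM => //; nra.
have h2 : 0 <= (n + 1) / k ^+ 2 by rewrite divr_ge0 ?exprn_ge0//; lra.
move=> /(ler_wpM2r h2).
have : (n + 1) / k - x * (2 - 3 / 2 * x) * (2 / 3) * ((n + 1) / k ^+ 2) <=
   (1 - 1 / (3 * n)) * (n / k) + 1 / n; last by lra.
rewrite -subr_ge0.
set d := (X in 0 <= X).
have -> : d = (4 / 3 - x) / (n * k).
  by rewrite /d /x; field; rewrite !gt_eqF//; lra.
by rewrite divr_ge0//; nra.
Qed.

End StepProbability.

(** * Drift estimates below the threshold *)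

Section Recurrent.
Context {R : realFieldType}.
Implicit Types beta n s k x y h : R.

(** Concavity of [y / (1 + y)]. *)
Lemma frac_tangent x y : 0 <= x -> 0 <= y ->
  y / (1 + y) <= x / (1 + x) + (y - x) / (1 + x) ^+ 2.
Proof.
move=> x0 y0; rewrite -subr_ge0; set d := (X in 0 <= X).
have -> : d = (y - x) ^+ 2 / ((1 + x) ^+ 2 * (1 + y)).
  by rewrite /d; field; rewrite !gt_eqF//; lra.
by rewrite divr_ge0 ?sqr_ge0// mulr_ge0 ?exprn_ge0//; lra.
Qed.

(** A decrease by at least [h] puts the concave function [y / (1 + y)] strictly
below its tangent at [x]. This is where the noise of the walk enters. *)
Lemma frac_tangent_gap x y h : 0 <= h -> 0 <= y -> y <= x - h ->
  y / (1 + y) <= x / (1 + x) + (y - x) / (1 + x) ^+ 2 - h ^+ 2 / (1 + x) ^+ 3.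
Proof.
move=> h0 y0 yx; rewrite -subr_ge0; set d := (X in 0 <= X).
have -> : d = (y - x) ^+ 2 / ((1 + x) ^+ 2 * (1 + y)) - h ^+ 2 / (1 + x) ^+ 3.
  by rewrite /d; field; rewrite !gt_eqF//; lra.
rewrite subr_ge0 ler_pM ?sqr_ge0 ?invr_ge0 ?exprn_ge0//; [lra| |].
  by rewrite -subr_ge0 subr_sqr; nra.
rewrite lef_pV2 ?posrE ?exprn_gt0 ?mulr_gt0 ?exprn_gt0//; try lra.
by rewrite [in leRHS]exprSr ler_wpM2l ?exprn_ge0//; lra.
Qed.

(** For [beta = 3 / 8] and up to smaller terms, the left side is [s] times
[1 + 3 / 8 * (2 - x) / n - (2 - 3 / 2 * x) / (4 * n)] with [x = k / n], and [x]
disappears from this expression. The cancellation singles out the power [1 / 4] of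
[k]: the factor [1 - 1 / (4 * k)] is the decrease of [k ^ (- 1 / 4)] in one move. *)
Lemma recurrent_linear_drift beta n s k :
  let q := up_prob beta n s k + up_prob beta n (- s) k in
  -1 <= beta -> beta <= 3 / 8 -> 2 <= n -> 2 <= k -> k <= n -> 0 <= s ->
  up_prob beta n s k * ((s + 1) * (1 - 1 / (4 * k))) +
  up_prob beta n (- s) k * ((s - 1) * (1 - 1 / (4 * k))) + (1 - q) * s <=
  s * (1 + 1 / (4 * n)).
Proof.
move=> q b1 b2 n2 k2 kn s0.
have n0 : 0 < n by lra.
have k0 : 0 < k by lra.
have -> : up_prob beta n s k * ((s + 1) * (1 - 1 / (4 * k))) +
  up_prob beta n (- s) k * ((s - 1) * (1 - 1 / (4 * k))) + (1 - q) * s =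
  s - q * (s / (4 * k)) + (up_prob beta n s k - up_prob beta n (- s) k) * (1 - 1 / (4 * k)).
  by rewrite /q; field; rewrite gt_eqF.
rewrite up_prob_drift//.
set x := k / n; have x1 : x <= 1 by rewrite ler_pdivrMr// mul1r.
have x0 : 0 < x by rewrite divr_gt0.
have qx : x * (2 - 3 / 2 * x) <= q.
  by rewrite /q up_prob_move// lerDl divr_ge0 ?sqr_ge0.
have sk0 : 0 <= s / (4 * k) by rewrite divr_ge0//; lra.
have h1 := ler_wpM2r sk0 qx.
(* the factor k in the number of moves cancels the 1 / k in the loss per move *)
have e1 : x * (2 - 3 / 2 * x) * (s / (4 * k)) = (2 - 3 / 2 * x) / 4 * (s / n).
  by rewrite /x; field; rewrite !gt_eqF.
have sn0 : 0 <= s / n by rewrite divr_ge0//; lra.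
have h2 : 0 <= 1 - 1 / (4 * k) <= 1.
  have : 0 <= 1 / (4 * k) <= 1 by rewrite divr_ge0 ?ler_pdivrMr; lra.
  lra.
have h3 : beta * (2 - x) * s / n * (1 - 1 / (4 * k)) <= 3 / 8 * (2 - x) * (s / n).
  have h4 : 0 <= (2 - x) * (s / n) by rewrite mulr_ge0//; lra.
  have -> : beta * (2 - x) * s / n * (1 - 1 / (4 * k)) =
     beta * (1 - 1 / (4 * k)) * ((2 - x) * (s / n)) by ring.
  rewrite -[leRHS]mulrA ler_wpM2r//.
  nra.
have -> : s * (1 + 1 / (4 * n)) = s + (s / n) / 4 by field; rewrite gt_eqF.
lra.
Qed.

(** The factor [h] stands for [(k * n) ^ (- 1 / 4)]; a move multiplies it by [r]
and the passage of time by [t], and [t * (1 + 1 / (4 * n)) <= 1] compensates the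
remaining drift. A step towards the origin lowers [s * h] by at least [h], which
makes the second inequality strict. *)
Lemma recurrent_drift beta n s k h : -1 <= beta -> beta <= 3 / 8 ->
  2 <= n -> 2 <= k -> k <= n -> 1 <= s <= k -> 0 <= h ->
  let r := 1 - 1 / (4 * k) in let t := 1 - 1 / (4 * n) in
  let F y := y / (1 + y) in
  let q := up_prob beta n s k + up_prob beta n (- s) k in
  [/\ up_prob beta n s k * ((s + 1) * (h * r * t)) +
      up_prob beta n (- s) k * ((s - 1) * (h * r * t)) + (1 - q) * (s * (h * t)) <= s * h
   & up_prob beta n s k * F ((s + 1) * (h * r * t)) +
     up_prob beta n (- s) k * F ((s - 1) * (h * r * t)) + (1 - q) * F (s * (h * t)) <=
     F (s * h) - up_prob beta n (- s) k * (h ^+ 2 / (1 + s * h) ^+ 3)].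
Proof.
move=> b1 b2 n2 k2 kn /andP[s1 sk] h0 r t F q.
have n0 : 0 < n by lra.
have k0 : 0 < k by lra.
have r01 : 0 <= r <= 1.
  have : 0 <= 1 / (4 * k) <= 1 by rewrite divr_ge0 ?ler_pdivrMr; lra.
  rewrite /r; lra.
have t01 : 0 <= t <= 1.
  have : 0 <= 1 / (4 * n) <= 1 by rewrite divr_ge0 ?ler_pdivrMr; lra.
  rewrite /t; lra.
have ht0 : 0 <= h * t by rewrite mulr_ge0//; lra.
have hrt0 : 0 <= h * r * t by rewrite !mulr_ge0//; lra.
have lin : up_prob beta n s k * ((s + 1) * (h * r * t)) +
      up_prob beta n (- s) k * ((s - 1) * (h * r * t)) + (1 - q) * (s * (h * t)) <= s * h.
  have s0 : 0 <= s by lra.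
  have /(ler_wpM2r ht0) := recurrent_linear_drift b1 b2 n2 k2 kn s0.
  rewrite -/q -/r.
  have -> : (up_prob beta n s k * ((s + 1) * r) + up_prob beta n (- s) k * ((s - 1) * r) +
    (1 - q) * s) * (h * t) = up_prob beta n s k * ((s + 1) * (h * r * t)) +
      up_prob beta n (- s) k * ((s - 1) * (h * r * t)) + (1 - q) * (s * (h * t)) by ring.
  move/le_trans; apply.
  have -> : s * (1 + 1 / (4 * n)) * (h * t) = s * h * (1 - (1 / (4 * n)) ^+ 2).
    by rewrite /t; ring.
  rewrite ler_piMr ?mulr_ge0//.
  have := sqr_ge0 (1 / (4 * n)); lra.
split=> //.
have bb : -1 <= beta <= 1 by lra.
have nsk : `|s| <= k by rewrite ger0_norm; lra.
have nsk' : `|- s| <= k by rewrite normrN.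
have up0 := up_prob_ge0 bb n0 nsk kn.
have dn0 := up_prob_ge0 bb n0 nsk' kn.
have q1 := up_prob_move_le1 bb n0 nsk kn.
have M0 : 0 <= s * h by rewrite mulr_ge0//; lra.
have M1 : 0 <= (s + 1) * (h * r * t) by rewrite mulr_ge0//; lra.
have M2 : 0 <= (s - 1) * (h * r * t) by rewrite mulr_ge0//; lra.
have M3 : 0 <= s * (h * t) by rewrite mulr_ge0//; lra.
have M2h : (s - 1) * (h * r * t) <= s * h - h.
  have -> : s * h - h = (s - 1) * h by ring.
  rewrite ler_wpM2l//; first lra.
  by rewrite -mulrA ler_piMr// mulr_ile1//; lra.
have q0 : 0 <= 1 - q by rewrite subr_ge0.
have f1 := ler_wpM2l up0 (frac_tangent M0 M1).
have f2 := ler_wpM2l dn0 (frac_tangent_gap h0 M2 M2h).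
have f3 := ler_wpM2l q0 (frac_tangent M0 M3).
rewrite /F; apply: le_trans (lerD (lerD f1 f2) f3) _.
set A := (s + 1) * (h * r * t) in lin *.
set B := (s - 1) * (h * r * t) in lin *.
set C := s * (h * t) in lin *.
set M := s * h in lin *.
set i := ((1 + M) ^+ 2)^-1.
have i0 : 0 <= i by rewrite invr_ge0 sqr_ge0.
have : (up_prob beta n s k * A + up_prob beta n (- s) k * B + (1 - q) * C - M) * i <= 0.
  by rewrite mulr_le0_ge0// subr_le0.
rewrite /q; set X := _ / (1 + M) ^+ 3; set Y := M / (1 + M).
lra.
Qed.
End Recurrent.

(** * Drift estimates above the threshold *)

Section Transient.
Context {R : realFieldType}.
Implicit Types beta c n s k w : R.

(** Second order expansion at [w]; the exact remainder has [c + w'] in place of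
the last [c]. *)
Lemma inv_expand c w w' : 1 <= c -> 0 <= w -> 0 <= w' ->
  (c + w')^-1 <=
  (c + w)^-1 - ((w' - w) - (w' - w) ^+ 2 / c) * ((c + w)^-1) ^+ 2.
Proof.
move=> c1 w0 w0'; rewrite -subr_ge0; set d := (X in 0 <= X).
have -> : d = (w' - w) ^+ 2 * w' / (c * (c + w') * (c + w) ^+ 2).
  by rewrite /d; field; rewrite !gt_eqF//; lra.
apply: divr_ge0 (mulr_ge0 (sqr_ge0 _) w0') (mulr_ge0 _ (sqr_ge0 _)).
by apply: mulr_ge0; lra.
Qed.

(** Apart from terms that are quadratic in [s / n] or due to discretization, the
logarithmic drift of [2 * n + 3 * k] is at most [3 / 4 * (2 - k / n) / n], with
equality at the equilibrium density [k / n = 2 / 3], while that of [s ^ 2] is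
[2 * beta * (2 - k / n) / n] plus the effect of the variance. With this
denominator the drift of the ratio has a sign at every density as soon as
[beta > 3 / 8]; with [n] alone it would not. *)
Definition spread n s k : R := s ^+ 2 / (2 * n + 3 * k).

Lemma spread_ge0 n s k : 0 <= n -> 0 <= k -> 0 <= spread n s k.
Proof. by move=> n0 k0; rewrite divr_ge0 ?sqr_ge0//; lra. Qed.

(** The first term comes from the outward drift and the second one from the
variance of the step, which keeps the drift of [w] positive at the origin. The
last one collects the discretization errors and the increase of the probability
of a move caused by [s], which is of order [(s / n) ^ 2]. *)
Lemma spread_drift beta n s k :
  let pu := up_prob beta n s k in let pd := up_prob beta n (- s) k in
  let w := spread n s k in
  3 / 8 <= beta -> beta <= 1 -> 2 <= n -> 0 <= k -> k <= n -> `|s| <= k ->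
  (2 * beta - 3 / 4) * w / n + k / n / (20 * n) -
    (10 * w + 3 / 2 * w ^+ 2) / n ^+ 2
  <= pu * (spread (n + 1) (s + 1) (k + 1) - w) +
     pd * (spread (n + 1) (s - 1) (k + 1) - w) +
     (1 - (pu + pd)) * (spread (n + 1) s k - w) :> R.
Proof.
move=> pu pd w b0 b1 n2 k0 kn sk.
have n0 : 0 < n by lra.
set G := 2 * n + 3 * k.
have G2n : 2 * n <= G by rewrite /G; lra.
have G0 : 0 < G by lra.
have w0 : 0 <= w by rewrite divr_ge0 ?sqr_ge0// ltW.
have s2w : s ^+ 2 = w * G by rewrite /w /spread mulfVK// gt_eqF.
have bb : -1 <= beta <= 1 by lra.
have nsk : `|- s| <= k by rewrite normrN.
have pu0 : 0 <= pu by exact: up_prob_ge0.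
have pd0 : 0 <= pd by exact: up_prob_ge0.
set x := k / n.
have x0 : 0 <= x by rewrite divr_ge0// ltW.
have x1 : x <= 1 by rewrite ler_pdivrMr// mul1r.
set q := pu + pd.
set sD := beta * (2 - x) * w * G / n.
have sDE : s * (pu - pd) = sD.
  by rewrite /pu /pd up_prob_drift// -/x /sD -(mulrA _ w) -s2w; field; rewrite gt_eqF.
have -> : pu * (spread (n + 1) (s + 1) (k + 1) - w) +
     pd * (spread (n + 1) (s - 1) (k + 1) - w) +
     (1 - q) * (spread (n + 1) s k - w) =
  - (1 - q) * (2 * w / (G + 2)) - 5 * q * w / (G + 5) + (2 * sD + q) / (G + 5).
  rewrite /spread.
  have -> : 2 * (n + 1) + 3 * (k + 1) = G + 5 by rewrite /G; ring.
  have -> : 2 * (n + 1) + 3 * k = G + 2 by rewrite /G; ring.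
  rewrite -sDE.
  have -> : (s + 1) ^+ 2 = w * G + 2 * s + 1 by rewrite -s2w; ring.
  have -> : (s - 1) ^+ 2 = w * G - 2 * s + 1 by rewrite -s2w; ring.
  by rewrite s2w /q; field; rewrite !gt_eqF//; lra.
have q1 : q <= 1 by exact: up_prob_move_le1.
have q0 : 0 <= q by rewrite addr_ge0.
have qE : q = x * (2 - 3 / 2 * x) + (beta * s / n) ^+ 2 / 2 by rewrite /q up_prob_move.
have iG0 : 0 < G^-1 by rewrite invr_gt0.
have iG : G^-1 <= n^-1 / 2.
  by rewrite -invfM lef_pV2 ?posrE ?mulr_gt0//; lra.
have in0 : 0 < n^-1 by rewrite invr_gt0.
have wG : 0 <= w * G^-1 by rewrite mulr_ge0// ltW.
have t1 : - (1 - q) * (2 * w / (G + 2)) - 5 * q * w / (G + 5) >=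
    - (2 + 3 * q) * (w * G^-1).
  have h2 : w / (G + 2) <= w * G^-1 by rewrite ler_wpM2l// lef_pV2 ?posrE//; lra.
  have h5 : w / (G + 5) <= w * G^-1 by rewrite ler_wpM2l// lef_pV2 ?posrE//; lra.
  have q1' : 0 <= 1 - q by lra.
  have := ler_wpM2l q1' h2; have := ler_wpM2l q0 h5; lra.
have t2 : 2 * beta * (2 - x) * w / n - 10 * w / n ^+ 2 <= 2 * sD / (G + 5).
  have -> : 2 * sD / (G + 5) = 2 * beta * (2 - x) * w / n -
      5 * (2 * beta * (2 - x)) * (w * n^-1 * (G + 5)^-1).
    by rewrite /sD; field; rewrite !gt_eqF//; lra.
  have h : 0 <= w * n^-1 * (G + 5)^-1 <= w * n^-1 * (n^-1 / 2).
    have wn : 0 <= w * n^-1 by rewrite mulr_ge0// ltW.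
    have iG5 : (G + 5)^-1 <= n^-1 / 2.
      by apply: le_trans iG; rewrite lef_pV2 ?posrE//; lra.
    by rewrite ler_wpM2l// mulr_ge0// invr_ge0; lra.
  have -> : 10 * w / n ^+ 2 = 20 * (w * n^-1 * (n^-1 / 2)).
    by field; rewrite gt_eqF.
  have : 0 <= beta * (2 - x) <= 2 by nra.
  move: h; set y := w * n^-1 * (G + 5)^-1; set z := w * n^-1 * _.
  by move=> /andP[y0 yz] /andP[c0 c2]; nra.
have t3 : x / (20 * n) <= q / (G + 5).
  have -> : x / (20 * n) = x / 2 / (10 * n) by field; rewrite gt_eqF.
  rewrite ler_pM ?invr_ge0//; try lra.
    by rewrite qE; have := sqr_ge0 (beta * s / n); nra.
  by rewrite lef_pV2 ?posrE//; rewrite /G; lra.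
(* the logarithmic drift of the denominator; the gap between the two sides of
   the quadratic inequality used here is (1 - 3 / 2 * x) ^ 2 *)
have t4 : (2 + 3 * q) * (w * G^-1) <=
    3 / 4 * (2 - x) * (w / n) + 3 / 2 * w ^+ 2 / n ^+ 2.
  rewrite qE.
  have -> : (2 + 3 * (x * (2 - 3 / 2 * x) + (beta * s / n) ^+ 2 / 2)) * (w * G^-1) =
     (2 + 3 * (x * (2 - 3 / 2 * x))) * (w * G^-1) +
     beta ^+ 2 * (3 / 2 * w ^+ 2 / n ^+ 2).
    by rewrite expr_div_n exprMn s2w; field; rewrite !gt_eqF.
  apply: lerD.
    rewrite (_ : 3 / 4 * (2 - x) * (w / n) = (3 / 4 * (2 - x) * (2 + 3 * x)) * (w * G^-1)).
      rewrite ler_wpM2r//.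
      by have := sqr_ge0 (1 - 3 / 2 * x); lra.
    by rewrite /G /x; field; rewrite !gt_eqF//; rewrite /G in G0; lra.
  have b00 : 0 <= beta by lra.
  have w2n : 0 <= 3 / 2 * w ^+ 2 / n ^+ 2.
    by apply: divr_ge0 (mulr_ge0 _ (sqr_ge0 _)) (sqr_ge0 _); lra.
  by rewrite ler_piMl ?exprn_ile1.
have wn0 : 0 <= w / n by rewrite mulr_ge0// ltW.
have t5 : (2 * beta - 3 / 4) * w / n <= (2 - x) * (2 * beta - 3 / 4) * (w / n).
  by rewrite -mulrA ler_wpM2r//; nra.
lra.
Qed.

(** A move changes [w] by about [2 * s / (2 * n + 3 * k)], whose square is
[4 * w / (2 * n + 3 * k)]. *)
Lemma spread_sqr pu pd n s k :
  let w := spread n s k in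
  0 <= pu -> 0 <= pd -> pu + pd <= 1 -> 2 <= n -> 0 <= k ->
  pu * (spread (n + 1) (s + 1) (k + 1) - w) ^+ 2 +
  pd * (spread (n + 1) (s - 1) (k + 1) - w) ^+ 2 +
  (1 - (pu + pd)) * (spread (n + 1) s k - w) ^+ 2 <=
  6 * w / n + (1 + 20 * w ^+ 2) / n ^+ 2 :> R.
Proof.
move=> w pu0 pd0 pq1 n2 k0.
have n0 : 0 < n by lra.
set G := 2 * n + 3 * k.
have G2n : 2 * n <= G by rewrite /G; lra.
have G0 : 0 < G by lra.
have w0 : 0 <= w by rewrite divr_ge0 ?sqr_ge0// ltW.
have s2w : s ^+ 2 = w * G by rewrite /w /spread mulfVK// gt_eqF.
set B := (X in _ <= X).
suff [h1 h2 h3] : [/\ (spread (n + 1) (s + 1) (k + 1) - w) ^+ 2 <= B,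
    (spread (n + 1) (s - 1) (k + 1) - w) ^+ 2 <= B &
    (spread (n + 1) s k - w) ^+ 2 <= B].
  have := ler_wpM2l pu0 h1; have := ler_wpM2l pd0 h2.
  have pz0 : 0 <= 1 - (pu + pd) by lra.
  have := ler_wpM2l pz0 h3; lra.
have iG : G^-1 <= n^-1 / 2.
  by rewrite -invfM lef_pV2 ?posrE ?mulr_gt0//; lra.
have iG0 : 0 <= G^-1 by rewrite invr_ge0 ltW.
have iG2 : G^-1 ^+ 2 <= n^-1 ^+ 2 / 4.
  have -> : n^-1 ^+ 2 / 4 = (n^-1 / 2) ^+ 2 by field; rewrite gt_eqF.
  by rewrite lerXn2r ?nnegrE// (le_trans iG0).
have iG5 : (G + 5)^-1 <= G^-1 by rewrite lef_pV2 ?posrE//; lra.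
have iG50 : 0 <= (G + 5)^-1 by rewrite invr_ge0; lra.
have iG52 : (G + 5)^-1 ^+ 2 <= G^-1 ^+ 2 by rewrite lerXn2r ?nnegrE.
have i20 := sqr_ge0 (n^-1 : R).
have move_case y : y ^+ 2 = 4 * s ^+ 2 -> ((y + 1 - 5 * w) / (G + 5)) ^+ 2 <= B.
  move=> ys.
  have h1 : (y + 1 - 5 * w) ^+ 2 <= 12 * s ^+ 2 + (3 + 75 * w ^+ 2).
    have -> : 12 * s ^+ 2 = 3 * y ^+ 2 by rewrite ys; ring.
    nra.
  have h2 : 0 <= 12 * s ^+ 2 + (3 + 75 * w ^+ 2).
    by have := sqr_ge0 s; have := sqr_ge0 w; lra.
  rewrite expr_div_n -exprVn.
  apply: (@le_trans _ _ ((12 * s ^+ 2 + (3 + 75 * w ^+ 2)) * G^-1 ^+ 2)).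
    by rewrite ler_pM ?sqr_ge0.
  rewrite mulrDl.
  have -> : 12 * s ^+ 2 * G^-1 ^+ 2 = 12 * w * G^-1.
    by rewrite s2w; field; rewrite gt_eqF.
  have h3 : 0 <= 12 * w by lra.
  have := ler_wpM2l h3 iG.
  have h4 : 0 <= 3 + 75 * w ^+ 2 by have := sqr_ge0 w; lra.
  have := ler_wpM2l h4 iG2.
  rewrite /B -exprVn; set i := n^-1 in i20 *; set W := w ^+ 2.
  have : 0 <= W * i ^+ 2 by rewrite mulr_ge0 ?sqr_ge0.
  lra.
have G5 : 2 * (n + 1) + 3 * (k + 1) = G + 5 by rewrite /G; ring.
have G2 : 2 * (n + 1) + 3 * k = G + 2 by rewrite /G; ring.
split.
- rewrite /spread G5 (_ : _ - w = (2 * s + 1 - 5 * w) / (G + 5)); last first.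
    have -> : (s + 1) ^+ 2 = w * G + (2 * s + 1) by rewrite -s2w; ring.
    by field; rewrite gt_eqF//; lra.
  by apply: move_case; ring.
- rewrite /spread G5 (_ : _ - w = (- (2 * s) + 1 - 5 * w) / (G + 5)); last first.
    have -> : (s - 1) ^+ 2 = w * G + (- (2 * s) + 1) by rewrite -s2w; ring.
    by field; rewrite gt_eqF//; lra.
  by apply: move_case; ring.
- rewrite /spread G2 s2w (_ : _ - w = - (2 * w / (G + 2))); last first.
    by field; rewrite gt_eqF//; lra.
  rewrite sqrrN expr_div_n.
  have h : ((G + 2) ^+ 2)^-1 <= G^-1 ^+ 2.
    by rewrite -exprVn lerXn2r ?nnegrE ?invr_ge0// ?lef_pV2 ?posrE//; lra.
  apply: le_trans (ler_wpM2l (sqr_ge0 _) h) _.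
  apply: le_trans (ler_wpM2l (sqr_ge0 _) iG2) _.
  rewrite /B -exprVn; set i := n^-1 in i20 *; set W := w ^+ 2.
  have : 0 <= W * i ^+ 2 by rewrite mulr_ge0 ?sqr_ge0.
  have : 0 <= w * i by rewrite mulr_ge0// invr_ge0 ltW.
  rewrite exprMn -/W; lra.
Qed.

(** In the second order expansion of [V], the term [6 * w / n] of [spread_sqr] is
divided by [c], and the outward drift absorbs it for [c] large. What remains is
the effect of the variance, up to a summable error. *)
Lemma transient_drift beta n s k c :
  let pu := up_prob beta n s k in let pd := up_prob beta n (- s) k in
  let w := spread n s k in let V y := (c + y)^-1 in
  beta <= 1 -> 2 <= n -> 0 <= k -> k <= n -> `|s| <= k ->
  1 <= c -> 6 <= c * (2 * beta - 3 / 4) ->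
  pu * V (spread (n + 1) (s + 1) (k + 1)) +
  pd * V (spread (n + 1) (s - 1) (k + 1)) +
  (1 - (pu + pd)) * V (spread (n + 1) s k) <=
  V w - k / n / (20 * n) * V w ^+ 2 + 22 / n ^+ 2 :> R.
Proof.
move=> pu pd w V b1 n2 k0 kn sk c1 cg.
have n0 : 0 < n by lra.
have b0 : 3 / 8 <= beta by nra.
have bb : -1 <= beta <= 1 by lra.
have nsk : `|- s| <= k by rewrite normrN.
have pu0 : 0 <= pu by exact: up_prob_ge0.
have pd0 : 0 <= pd by exact: up_prob_ge0.
have pq1 : pu + pd <= 1 by exact: up_prob_move_le1.
have w0 : 0 <= w by apply: spread_ge0; lra.
have W1 : 0 <= spread (n + 1) (s + 1) (k + 1) by apply: spread_ge0; lra.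
have W2 : 0 <= spread (n + 1) (s - 1) (k + 1) by apply: spread_ge0; lra.
have W3 : 0 <= spread (n + 1) s k by apply: spread_ge0; lra.
set x := k / n.
have pz0 : 0 <= 1 - (pu + pd) by lra.
have h1 := ler_wpM2l pu0 (inv_expand c1 w0 W1).
have h2 := ler_wpM2l pd0 (inv_expand c1 w0 W2).
have h3 := ler_wpM2l pz0 (inv_expand c1 w0 W3).
apply: le_trans (lerD (lerD h1 h2) h3) _.
have sd := spread_drift b0 b1 n2 k0 kn sk.
have ss := spread_sqr s pu0 pd0 pq1 n2 k0.
rewrite -/pu -/pd -/w in sd ss.
set D1 := spread _ (s + 1) _ - w in sd ss *.
set D2 := spread _ (s - 1) _ - w in sd ss *.
set D3 := spread _ s _ - w in sd ss *.
rewrite -/x in sd; set v := V w; rewrite -/(V w) -/v.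
set E1 := pu * D1 + _ + _ in sd.
set E2 := pu * D1 ^+ 2 + _ + _ in ss.
have -> : pu * (v - (D1 - D1 ^+ 2 / c) * v ^+ 2) +
  pd * (v - (D2 - D2 ^+ 2 / c) * v ^+ 2) +
  (1 - (pu + pd)) * (v - (D3 - D3 ^+ 2 / c) * v ^+ 2) = v - (E1 - E2 / c) * v ^+ 2.
  by rewrite /E1 /E2; field; rewrite gt_eqF//; lra.
have v0 : 0 <= v by rewrite invr_ge0; lra.
(* V is at most 1 / (1 + w), so its square absorbs the quadratic error in w *)
suff h : x / (20 * n) - (1 + 10 * w + 22 * w ^+ 2) / n ^+ 2 <= E1 - E2 / c.
  have := ler_wpM2r (sqr_ge0 v) h.
  suff : (1 + 10 * w + 22 * w ^+ 2) / n ^+ 2 * v ^+ 2 <= 22 / n ^+ 2 by lra.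
  rewrite mulrAC ler_wpM2r ?invr_ge0 ?sqr_ge0//.
  rewrite /v /V exprVn ler_pdivrMr ?exprn_gt0//; last lra.
  nra.
have ic0 : 0 <= c^-1 by rewrite invr_ge0; lra.
have ic1 : c^-1 <= 1 by rewrite invf_le1; lra.
have := ler_wpM2r ic0 ss.
rewrite mulrDl.
have wn0 : 0 <= w / n by rewrite divr_ge0// ltW.
have : 6 * w / n / c <= (2 * beta - 3 / 4) * w / n.
  rewrite ler_pdivrMr; last lra.
  have := ler_wpM2r wn0 cg; lra.
have : (1 + 20 * w ^+ 2) / n ^+ 2 / c <= (1 + 20 * w ^+ 2) / n ^+ 2.
  rewrite ler_piMr// divr_ge0 ?sqr_ge0//.
  have := sqr_ge0 w; lra.
have : 0 <= w ^+ 2 / n ^+ 2 by rewrite divr_ge0 ?sqr_ge0.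
rewrite -/E2; lra.
Qed.
End Transient.

(** * Expectations over histories *)

Definition sign_of (e : bool) : int := if e then 1 else -1.

Definition displacement (x : seq int) : int := \sum_(y <- x) y.

Definition moves (x : seq int) : nat := count (fun y => y != 0) x.

Definition is_step (y : int) : bool := y \in [:: 1; -1; 0].

(** The index [n] corresponds to time [n.+2]: the two initial steps, which are
nonzero, precede all choices of the channels. *)
Definition history (n : nat) (x : seq int) : bool :=
  [&& size x == n.+2, all is_step x & (2 <= moves x)%N].

Lemma displacement_rcons x y : displacement (rcons x y) = displacement x + y.
Proof. by rewrite /displacement -cats1 big_cat big_seq1. Qed.

Lemma moves_rcons x y : moves (rcons x y) = (moves x + (y != 0%R))%N.
Proof. by rewrite /moves -cats1 count_cat /= addn0. Qed.

Lemma is_stepP y : is_step y -> [\/ y = 1, y = -1 | y = 0].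
Proof.
rewrite /is_step !inE => /or3P[] /eqP ->.
- exact: Or31.
- exact: Or32.
- exact: Or33.
Qed.

Lemma norm_displacement_le x : all is_step x -> `|displacement x| <= (moves x)%:Z.
Proof.
rewrite /displacement /moves; elim: x => [|y x ih] /=; first by rewrite big_nil.
move=> /andP[/is_stepP y1 /ih {}ih]; rewrite big_cons.
by rewrite PoszD (le_trans (ler_normD _ _))// lerD//; case: y1 => ->.
Qed.

Lemma history_rcons n x y : history n x -> is_step y -> history n.+1 (rcons x y).
Proof.
move=> /and3P[/eqP sx ax mx] sy.
rewrite /history size_rcons sx eqxx all_rcons sy ax moves_rcons /=.
by rewrite (leq_trans mx)// leq_addr.
Qed.

Section Expectation.
Context {R : realFieldType} {p : R}.
Implicit Types (n : nat) (x : seq int) (f g : seq int -> R).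

(** Expectation of [g] at the report of one channel that draws its index from the
first [n] steps of [x]. *)
Definition channel n x (g : int -> R) : R :=
  \sum_(u < n) \sum_(e : bool)
    n%:R^-1 * (if e then p else 1 - p) * g (sign_of e * x`_u).

Definition transition n x f : R :=
  channel n x (fun y1 => channel n x (fun y2 => f (rcons x (sgz (y1 + y2))))).

(** Expectation of [f] at the first [n.+2] steps of the walk. Unfolding one step
at the end of the history turns every bound on [transition] into one on
[expect]. *)
Fixpoint expect n f : R :=
  if n is n'.+1 then expect n' (fun x => transition n'.+2 x f)
  else \sum_(a : bool) \sum_(b : bool) 4^-1 * f [:: sign_of a; sign_of b].

Let beta : R := 2 * p - 1.

(** The average over the steps [y] of [x] is affine in [y] and [y ^ 2], as [y] is
[1], [-1] or [0]; so it involves only the sum of the steps and the number of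
nonzero ones. *)
Lemma channelE n x (g : int -> R) : (0 < n)%N -> size x = n -> all is_step x ->
  let k := (moves x)%:R in let s := (displacement x)%:~R in
  channel n x g =
    (k + beta * s) / (2 * n%:R) * g 1 + (k - beta * s) / (2 * n%:R) * g (-1) +
    (1 - k / n%:R) * g 0.
Proof.
move=> n0 sx ax k s.
have -> : channel n x g = n%:R^-1 * \sum_(y <- x) (p * g y + (1 - p) * g (- y)).
  rewrite mulr_sumr (big_nth 0) sx big_mkord; apply: eq_bigr => u _.
  by rewrite big_bool /= mul1r mulN1r; ring.
have -> : \sum_(y <- x) (p * g y + (1 - p) * g (- y)) =
    (k + beta * s) / 2 * g 1 + (k - beta * s) / 2 * g (-1) + (n%:R - k) * g 0.
  rewrite /k /s /displacement /moves -sx {k s n0 sx}.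
  elim: x ax => [|y x ih] /=; first by rewrite !big_nil mulr0 addr0 subr0 mul0r !mul0r !addr0.
  move=> /andP[/is_stepP y1 /ih {}ih]; rewrite !big_cons ih rmorphD /=.
  move: (count _ _) (size x) => c z.
  case: y1 => -> /=; rewrite ?opprK ?oppr0 ?add0n ?add1n -?[c.+1%:R]natr1 -?[z.+1%:R]natr1;
    rewrite ?rmorphN ?rmorph1 ?rmorph0 /beta /=; by field.
by field; rewrite pnatr_eq0 -lt0n.
Qed.

Lemma transitionE n x f : history n x ->
  let k := (moves x)%:R in let s := (displacement x)%:~R in let N := n.+2%:R in
  transition n.+2 x f =
    up_prob beta N s k * f (rcons x 1) + up_prob beta N (- s) k * f (rcons x (-1)) +
    (1 - (up_prob beta N s k + up_prob beta N (- s) k)) * f (rcons x 0).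
Proof.
move=> /and3P[/eqP sx ax mx] k s N.
rewrite /transition channelE// !channelE//= -/k -/s -/N.
have sgzE : (sgz (1 + 1 : int) = 1) * (sgz (1 - 1 : int) = 0) *
  (sgz (-1 + 1 : int) = 0) * (sgz (-1 - 1 : int) = -1) * (sgz (1 + 0 : int) = 1) *
  (sgz (-1 + 0 : int) = -1) * (sgz (0 + 1 : int) = 1) * (sgz (0 - 1 : int) = -1) *
  (sgz (0 + 0 : int) = 0) by [].
rewrite !sgzE.
have N0 : N != 0 by rewrite pnatr_eq0.
by move: N N0 => N N0; rewrite /up_prob; field.
Qed.

(** The dynamics commutes with a global change of signs, so that [|s|] and [k]
form a Markov chain; for [s = 0] both directions lead to [|s| = 1]. *)
Lemma transition_sym n x (g : R -> R -> R) : history n x ->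
  let k := (moves x)%:R in let s := `|(displacement x)%:~R| in
  let N := n.+2%:R in
  transition n.+2 x (fun y => g `|(displacement y)%:~R| (moves y)%:R) =
    up_prob beta N s k * g (s + 1) (k + 1) + up_prob beta N (- s) k * g `|s - 1| (k + 1) +
    (1 - (up_prob beta N s k + up_prob beta N (- s) k)) * g s k.
Proof.
move=> hx k s N; rewrite transitionE//= !displacement_rcons !moves_rcons /=.
rewrite !addn0 !addn1 -[(moves x).+1%:R]natr1 -/k -/N !intrD mulrN1z mulr1z mulr0z addr0.
rewrite /s; set z := (displacement x)%:~R; case: (ger0P z) => h.
  by rewrite [`|z + 1|]ger0_norm// addr_ge0.
have -> : `|z - 1| = - z + 1 by rewrite ler0_norm; lra.
have -> : `|- z - 1| = `|z + 1| by rewrite -opprD normrN.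
by rewrite opprK (addrC (up_prob _ _ z _)) (addrC (_ * g _ _)).
Qed.

Lemma expect_lin n a f g :
  expect n (fun x => a * f x + g x) = a * expect n f + expect n g.
Proof.
have ch_lin N x b (g1 g2 : int -> R) :
    channel N x (fun y => b * g1 y + g2 y) = b * channel N x g1 + channel N x g2.
  rewrite /channel mulr_sumr -big_split; apply: eq_bigr => u _.
  by rewrite mulr_sumr -big_split; apply: eq_bigr => e _; rewrite mulrDr mulrCA.
have ch_eq N x (g1 g2 : int -> R) : g1 =1 g2 -> channel N x g1 = channel N x g2.
  by move=> h; apply: eq_bigr => u _; apply: eq_bigr => e _; rewrite h.
have ex_eq m f1 f2 : f1 =1 f2 -> expect m f1 = expect m f2.
  elim: m f1 f2 => [|m ih] f1 f2 h /=.
    by apply: eq_bigr => u _; apply: eq_bigr => e _; rewrite h.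
  apply: ih => x; rewrite /transition.
  by apply: (ch_eq) => y1; apply: (ch_eq) => y2; rewrite h.
elim: n f g => [|n ih] f g /=.
  rewrite mulr_sumr -big_split; apply: eq_bigr => u _.
  by rewrite mulr_sumr -big_split; apply: eq_bigr => e _; rewrite mulrDr mulrCA.
rewrite -ih; apply: ex_eq => x; rewrite /transition -ch_lin.
by apply: (ch_eq) => y1; rewrite ch_lin.
Qed.

Hypothesis p01 : 0 <= p <= 1.

Lemma history_bounds n x : history n x ->
  [/\ 2 <= n.+2%:R :> R, 2 <= (moves x)%:R :> R, (moves x)%:R <= n.+2%:R :> R
   & `|(displacement x)%:~R| <= (moves x)%:R :> R].
Proof.
move=> /and3P[/eqP sx ax mx]; split; rewrite ?ler_nat//.
  by rewrite -sx count_size.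
by rewrite -intr_norm -[leRHS]/((moves x)%:Z%:~R) ler_int norm_displacement_le.
Qed.

Lemma transition_le n x f g : history n x ->
  (forall y, is_step y -> f (rcons x y) <= g (rcons x y)) ->
  transition n.+2 x f <= transition n.+2 x g.
Proof.
move=> hx fg; have [n2 k2 kn sk] := history_bounds hx.
have N0 : 0 < n.+2%:R :> R by [].
have b1 : -1 <= beta <= 1 by have := p01; rewrite /beta; lra.
have sk' : `|- (displacement x)%:~R| <= (moves x)%:R :> R by rewrite normrN.
rewrite !transitionE// !lerD// ler_wpM2l ?fg//.
- exact: up_prob_ge0.
- exact: up_prob_ge0.
- by rewrite subr_ge0 up_prob_move_le1.
Qed.

Lemma expect_le n f g : (forall x, history n x -> f x <= g x) ->
  expect n f <= expect n g.
Proof.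
elim: n f g => [|n ih] f g fg /=.
  apply: ler_sum => a _; apply: ler_sum => b _.
  by rewrite ler_wpM2l ?invr_ge0// fg//; case: a b => [] [].
by apply: ih => x hx; apply: transition_le => // y hy; apply/fg/history_rcons.
Qed.

Lemma expect_eq n f g : (forall x, history n x -> f x = g x) ->
  expect n f = expect n g.
Proof. by move=> h; apply/le_anti; rewrite !expect_le// => x /h ->. Qed.

Lemma transition_cst n x c : history n x -> transition n.+2 x (fun=> c) = c.
Proof. by move=> hx; rewrite transitionE//=; ring. Qed.

Lemma expect_cst n c : expect n (fun=> c) = c.
Proof.
elim: n => [|n ih] /=; first by rewrite !big_bool /=; field.
by rewrite -[RHS]ih; apply: expect_eq => x hx; rewrite transition_cst.
Qed.

Lemma expectZ n a f : expect n (fun x => a * f x) = a * expect n f.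
Proof.
rewrite -[RHS]addr0 -[X in _ + X](expect_cst n 0) -expect_lin.
by apply: expect_eq => x _; rewrite addr0.
Qed.

Lemma expectD n f g : expect n (fun x => f x + g x) = expect n f + expect n g.
Proof.
rewrite -[X in X + _]mul1r -expect_lin.
by apply: expect_eq => x _; rewrite mul1r.
Qed.

Lemma expect_ge0 n f : (forall x, history n x -> 0 <= f x) -> 0 <= expect n f.
Proof. by rewrite -[X in X <= expect _ _](expect_cst n 0); exact: expect_le. Qed.

(** The recursion of [inverse_density_drift] has the fixed point [3]. *)
Lemma expect_inverse_density n :
  expect n (fun x => n.+2%:R / (moves x)%:R) <= 3.
Proof.
elim: n => [|n ih].
  apply: le_trans (_ : expect 0 (fun=> 1) <= _); last by rewrite expect_cst; lra.
  apply: expect_le => x /history_bounds[_ k2 _ _].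
  by rewrite ler_pdivrMr ?mul1r//; lra.
set N : R := n.+2%:R.
have N2 : 2 <= N by rewrite ler_nat.
have N0 : 0 < N by rewrite ltr0n.
have -> : n.+3%:R = N + 1 by rewrite natr1.
rewrite /=; apply: le_trans (_ : expect n (fun x =>
    (1 - 1 / (3 * N)) * (N / (moves x)%:R) + 1 / N) <= _).
  apply: expect_le => x hx; have [_ k2 kn sk] := history_bounds hx.
  rewrite (transition_sym (fun _ k => (N + 1) / k))//=.
  apply: le_trans (inverse_density_drift beta `|(displacement x)%:~R| N2 k2 kn).
  by rewrite /= -/N; lra.
rewrite expect_lin expect_cst.
have h : 0 <= 1 - 1 / (3 * N).
  by rewrite subr_ge0 ler_pdivrMr; lra.
apply: le_trans (lerD (ler_wpM2l h ih) (lexx _)) _.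
have -> : (1 - 1 / (3 * N)) * 3 + 1 / N = 3 by clearbody N; field; rewrite gt_eqF.
by [].
Qed.

End Expectation.

Arguments channel {R} p n x g.
Arguments transition {R} p n x f.
Arguments expect {R} p n f.

(** * Avoiding the origin *)

(** Both regimes end here: a nonnegative Lyapunov function cannot lose a multiple
of the harmonic series. *)
Lemma harmonic_descent_false (R : realType) (u : nat -> R) (c : R) (m : nat) :
  0 < c -> (forall n, 0 <= u n) ->
  ~ (forall n, (m <= n)%N -> u n.+1 <= u n - c / n.+2%:R).
Proof.
move=> c0 u0 hu; apply: (@dvg_harmonic R).
apply: nondecreasing_is_cvgn.
  by apply: nondecreasing_series => n _ _; exact: harmonic_ge0.
suff h n : (m <= n)%N -> series (@harmonic R) n.+1 <= series harmonic m.+1 + (u m - u n) / c.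
  exists (series harmonic m.+1 + u m / c) => _ [n _ <-].
  apply: (@le_trans _ _ (series harmonic (maxn m n).+1)).
    have : {homo series (@harmonic R) : i j / (i <= j)%N >-> i <= j}.
      by apply: nondecreasing_series => i _ _; exact: harmonic_ge0.
    by apply; rewrite ltnW// ltnS leq_maxr.
  apply: le_trans (h _ (leq_maxl _ _)) _; rewrite lerD2l ler_pM2r ?invr_gt0//.
  by rewrite gerBl.
elim: n => [|n ih]; first by rewrite leqn0 => /eqP ->; rewrite subrr mul0r addr0.
rewrite leq_eqVlt => /orP[/eqP <-|]; first by rewrite subrr mul0r addr0.
rewrite ltnS => mn; rewrite seriesSr.
have -> : (u m - u n.+1) / c = (u m - u n) / c + (u n - u n.+1) / c.
  by rewrite -mulrDl; congr (_ / _); ring.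
rewrite addrA lerD ?ih// /harmonic /= ler_pdivlMr// mulrC.
by rewrite lerBrDr addrC -lerBrDr; exact: hu.
Qed.

(** No visit to the origin between time [m] and the end of the history; this is
true when [m] lies beyond the end. *)
Definition avoids (m : nat) (x : seq int) : bool :=
  all (fun j => displacement (take j x) != 0) (iota m ((size x).+1 - m)).

Lemma avoids_rcons m x y : (m <= (size x).+1)%N ->
  avoids m (rcons x y) = avoids m x && (displacement (rcons x y) != 0).
Proof.
move=> mx; rewrite /avoids size_rcons subSn// -addn1 iotaD all_cat /=.
rewrite subnKC// andbT; congr andb; last by rewrite take_oversize// size_rcons.
apply: eq_in_all => j; rewrite mem_iota subnKC// => /andP[_ jx].
by rewrite -cats1 takel_cat.
Qed.

Lemma avoids_start x : avoids (size x) x = (displacement x != 0).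
Proof. by rewrite /avoids subSnn /= take_size andbT. Qed.

Lemma avoids_last m x : (m <= size x)%N -> avoids m x -> displacement x != 0.
Proof.
move=> mx /allP /(_ (size x)); rewrite take_size; apply.
by rewrite mem_iota mx subnKC ?(leqW mx)//=.
Qed.

(** * Recurrence estimates *)

Section Recurrence.
Context {R : realType} {p : R}.
Hypotheses (p0 : 0 < p) (p1 : p < 1).

(** A rational substitute for [j ^ (- 1 / 4)], with the exact relative decrement
that [recurrent_drift] asks for. *)
Definition weight (j : nat) : R := \prod_(2 <= i < j) (1 - 1 / (4 * i%:R)).

Lemma weightS j : (2 <= j)%N -> weight j.+1 = weight j * (1 - 1 / (4 * j%:R)).
Proof. by move=> j2; rewrite /weight big_nat_recr. Qed.

Lemma weight_gt0 j : 0 < weight j.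
Proof.
rewrite /weight big_nat; apply: prodr_gt0 => i /andP[i2 _].
have i2' : 2 <= i%:R :> R by rewrite ler_nat.
by rewrite subr_gt0 ltr_pdivrMr; lra.
Qed.

(** By Bernoulli's inequality [(1 - 1 / (4 * j)) ^ 4 >= 1 - 1 / j], so that
[weight j ^+ 4 * (j - 1)] is nondecreasing. *)
Lemma weight_lower j : (2 <= j)%N -> 1 <= weight j ^+ 4 * j%:R.
Proof.
move=> j2; suff h : 1 <= weight j ^+ 4 * (j%:R - 1).
  apply: le_trans h _; rewrite ler_wpM2l ?exprn_ge0 ?(ltW (weight_gt0 _))//; lra.
elim: j j2 => // j ih; rewrite leq_eqVlt => /orP[/eqP <-|].
  rewrite /weight big_geq// expr1n; lra.
rewrite ltnS => j2; rewrite weightS// exprMn -[j.+1%:R]natr1 addrK.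
apply: le_trans (ih j2) _.
rewrite -[leRHS]mulrA ler_wpM2l ?exprn_ge0 ?(ltW (weight_gt0 _))//.
have j2' : 2 <= j%:R :> R by rewrite ler_nat.
move: (j%:R) j2' => z z2.
have -> : z - 1 = (1 - 4 * (1 / (4 * z))) * z by field; lra.
have z0 : 0 <= z by lra.
rewrite ler_wpM2r//.
set v := 1 / (4 * z).
have v0 : 0 <= v by rewrite divr_ge0//; lra.
have v1 : v <= 1 by rewrite ler_pdivrMr; lra.
have h2 : 1 - 2 * v <= (1 - v) ^+ 2 by have := sqr_ge0 v; lra.
have -> : (1 - v) ^+ 4 = ((1 - v) ^+ 2) ^+ 2 by rewrite -exprM.
have := sqr_ge0 ((1 - v) ^+ 2 - 1); lra.
Qed.

(** The time of a history of index [n] is [n.+2]. *)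
Definition rescaling (n : nat) (x : seq int) : R := weight (moves x) * weight n.+2.

(** The supermartingale [M = |s| / (k * n) ^ (1 / 4)]. *)
Definition rescaled n x : R := `|(displacement x)%:~R| * rescaling n x.

Let e : R := Num.min p (1 - p).
Let beta : R := 2 * p - 1.

Let e0 : 0 < e. Proof. by rewrite /e lt_min p0 subr_gt0 p1. Qed.

Let be : 2 * e - 1 <= beta <= 1 - 2 * e.
Proof.
have h1 : e <= p by rewrite ge_min lexx.
have h2 : e <= 1 - p by rewrite ge_min lexx orbT.
by rewrite /beta; apply/andP; split; lra.
Qed.

Let p01 : 0 <= p <= 1. Proof. by rewrite !ltW. Qed.

Lemma rescaling_gt0 n x : 0 < rescaling n x.
Proof. by rewrite mulr_gt0// weight_gt0. Qed.

Lemma rescaled_ge0 n x : 0 <= rescaled n x.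
Proof. by rewrite mulr_ge0// ltW// rescaling_gt0. Qed.

(** The square behaves like [(k * n) ^ (- 1 / 2)], and [k <= n]. *)
Lemma rescaling_lower n x : history n x -> n.+2%:R^-1 <= rescaling n x ^+ 2.
Proof.
move=> hx; have [N2 k2 kN _] := history_bounds (R := R) hx.
have /and3P[_ _ m2] := hx.
have hk := weight_lower m2; have hn := weight_lower (isT : 2 <= n.+2)%N.
have s2 : 0 <= rescaling n x ^+ 2 by rewrite sqr_ge0.
have N0 : 0 < n.+2%:R :> R by [].
rewrite -ler_sqr ?nnegrE ?invr_ge0// -exprM exprVn.
rewrite -[leLHS]mul1r ler_pdivrMr ?exprn_gt0// /rescaling exprMn.
rewrite -[leLHS]mulr1; apply: le_trans (ler_pM _ _ hk hn) _ => //.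
rewrite mulrACA ler_wpM2l ?mulr_ge0 ?exprn_ge0 ?(ltW (weight_gt0 _))//.
by rewrite expr2 ler_wpM2r.
Qed.

Let avoidR m x : R := (avoids m.+2 x)%:R.

Lemma recurrent_transition n x : p <= 11 / 16 -> history n x ->
  displacement x != 0 ->
  transition p n.+2 x (rescaled n.+1) <= rescaled n x /\
  transition p n.+2 x (fun y => rescaled n.+1 y / (1 + rescaled n.+1 y)) <=
    rescaled n x / (1 + rescaled n x) -
    e ^+ 2 / n.+2%:R * ((moves x)%:R / n.+2%:R / (1 + rescaled n x) ^+ 3).
Proof.
move=> p11 hx dx.
have [N2 k2 kN sk] := history_bounds (R := R) hx.
have /and3P[_ _ m2] := hx.
have s1 : 1 <= `|(displacement x)%:~R| :> R.
  by rewrite -intr_norm ler1z -gtz0_ge1 normr_gt0.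
pose g (j : nat) := weight j * weight n.+3.
have lvl y : rescaled n.+1 y = `|(displacement y)%:~R| * g (moves y) by [].
set s : R := `|_| in sk s1.
set k : R := (moves x)%:R in k2 kN sk.
set h := rescaling n x.
have h0 : 0 <= h by rewrite ltW// rescaling_gt0.
have wN : weight n.+3 = weight n.+2 * (1 - 1 / (4 * n.+2%:R)) by exact: weightS.
have g1 : g (moves x).+1 = h * (1 - 1 / (4 * k)) * (1 - 1 / (4 * n.+2%:R)).
  by rewrite /g wN weightS// /h /rescaling -/k; ring.
have g0 : g (moves x) = h * (1 - 1 / (4 * n.+2%:R)).
  by rewrite /g wN /h /rescaling; ring.
have b1 : -1 <= beta by rewrite /beta; have := p0; lra.
have b2 : beta <= 3 / 8 by rewrite /beta; lra.
have tr (F : R -> R) : transition p n.+2 x (fun y => F (rescaled n.+1 y)) =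
    up_prob beta n.+2%:R s k *
      F ((s + 1) * (h * (1 - 1 / (4 * k)) * (1 - 1 / (4 * n.+2%:R)))) +
    up_prob beta n.+2%:R (- s) k *
      F ((s - 1) * (h * (1 - 1 / (4 * k)) * (1 - 1 / (4 * n.+2%:R)))) +
    (1 - (up_prob beta n.+2%:R s k + up_prob beta n.+2%:R (- s) k)) *
      F (s * (h * (1 - 1 / (4 * n.+2%:R)))).
  have := transition_sym (p := p) (fun s k => F (s * g (Num.trunc k))) hx.
  rewrite /= -/s -/k -/beta natr1 !natrK g1 g0 ger0_norm; last by rewrite subr_ge0.
  by move=> <-; congr (transition _ _ _ _); apply/funext => y; rewrite lvl natrK.
have [lin con] := recurrent_drift b1 b2 N2 k2 kN (introT andP (conj s1 sk)) h0.
split; first by rewrite (tr id).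
rewrite (tr (fun y => y / (1 + y))); apply: le_trans con _.
rewrite lerD2l lerN2.
have -> : rescaled n x = s * h by [].
have sh0 : 0 <= s * h by rewrite mulr_ge0//; lra.
have c0 : 0 <= ((1 + s * h) ^+ 3)^-1 by rewrite invr_ge0 exprn_ge0//; lra.
have sk' : `|- s| <= k by rewrite normrN /s normr_id.
have N0 : 0 < n.+2%:R :> R by [].
have := up_prob_ge (ltW e0) be N0 sk' kN.
have := rescaling_lower hx; rewrite -/h => hl up_l.
rewrite [leRHS]mulrA [leLHS](_ : _ = e ^+ 2 * (k / n.+2%:R) * n.+2%:R^-1 *
  ((1 + s * h) ^+ 3)^-1); last by ring.
by rewrite ler_wpM2r// ler_pM ?mulr_ge0 ?sqr_ge0 ?invr_ge0// ltW.
Qed.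

(** If the walk avoids the origin forever with probability at least [d], then so
it does, with probability at least [d / 2], while [M] and [n / k] are bounded:
their expectations are. On this event the loss of [M / (1 + M)] at time [n] is at
least a constant times [1 / n]. *)
Lemma recurrent_avoids m (d : R) : p <= 11 / 16 -> 0 < d ->
  exists2 n, (m <= n)%N & expect p n (avoidR m) < d.
Proof.
move=> p11 d0; apply: contrapT => hex.
have big n : (m <= n)%N -> d <= expect p n (avoidR m).
  by move=> mn; rewrite leNgt; apply/negP => lt; apply: hex; exists n.
have avoid_rcons n x y : (m <= n)%N -> history n x ->
    avoidR m (rcons x y) <= avoidR m x.
  move=> mn /and3P[/eqP sx _ _]; rewrite /avoidR avoids_rcons ?sx; last by lia.
  by rewrite ler_nat; case: (avoids _ _); case: (_ != 0).
have avoid_ge0 x : 0 <= avoidR m x by [].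
pose A n := expect p n (fun x => avoidR m x * rescaled n x).
pose B n := expect p n (fun x => avoidR m x * (rescaled n x / (1 + rescaled n x))).
pose D n := expect p n (fun x =>
  avoidR m x * ((moves x)%:R / n.+2%:R / (1 + rescaled n x) ^+ 3)).
(* one step of the process killed at the origin *)
have step n f g : (m <= n)%N -> (forall x, 0 <= f x) ->
    (forall x, history n x -> displacement x != 0 -> transition p n.+2 x f <= g x) ->
    expect p n.+1 (fun x => avoidR m x * f x) <= expect p n (fun x => avoidR m x * g x).
  move=> mn f0 fg; rewrite [leLHS]/=; apply: expect_le => // x hx.
  case avx : (avoids m.+2 x); last first.
    rewrite /avoidR avx mul0r -[leRHS](transition_cst (p := p) 0 hx).
    apply: transition_le => // y _.
    by rewrite mulr_le0_ge0// (le_trans (avoid_rcons _ _ _ mn hx))// /avoidR avx.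
  have dx : displacement x != 0.
    by apply: avoids_last avx; have /and3P[/eqP -> _ _] := hx.
  rewrite {2}/avoidR avx mul1r; apply: le_trans (fg _ hx dx).
  apply: transition_le => // y _; rewrite ler_piMl//.
  by rewrite /avoidR lern1 leq_b1.
have A_le n : (m <= n)%N -> A n <= A m.
  elim: n => [|n ih]; first by rewrite leqn0 => /eqP ->.
  rewrite leq_eqVlt => /orP[/eqP <- //|]; rewrite ltnS => mn.
  apply: le_trans (ih mn); apply: step => // [x|x hx dx]; first exact: rescaled_ge0.
  by have [] := recurrent_transition p11 hx dx.
have B_le n : (m <= n)%N -> B n.+1 <= B n - e ^+ 2 / n.+2%:R * D n.
  move=> mn; pose g x := rescaled n x / (1 + rescaled n x) -
    e ^+ 2 / n.+2%:R * ((moves x)%:R / n.+2%:R / (1 + rescaled n x) ^+ 3).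
  apply: le_trans (step n _ g mn _ _) _ => [x|x hx dx|].
  - by rewrite divr_ge0 ?addr_ge0 ?rescaled_ge0.
  - by have [] := recurrent_transition p11 hx dx.
  rewrite /B /D -mulNr -expectZ// -expectD//; apply: expect_le => // x _.
  by rewrite /g mulrBr mulNr (mulrCA _ (e ^+ 2 / _)).
have A0 : 0 <= A m by apply: expect_ge0 => // x _; rewrite mulr_ge0 ?rescaled_ge0.
pose eps := d / 12; pose a := 4 * A m / d + 1.
have eps0 : 0 < eps by rewrite divr_gt0.
have a0 : 0 < a by rewrite ltr_wpDl// divr_ge0 ?mulr_ge0// ltW.
have a_A : A m / a <= d / 4.
  rewrite ler_pdivrMr// /a mulrDr mulr1.
  have -> : d / 4 * (4 * A m / d) = A m by field; rewrite gt_eqF.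
  by lra.
pose L := (1 + a) ^+ 3 / eps.
have L0 : 0 < L by rewrite divr_gt0// exprn_gt0//; lra.
have D_ge n : (m <= n)%N -> d / 2 / L <= D n.
  move=> mn; rewrite ler_pdivrMr//.
  have : d <= L * D n + (eps * 3 + a^-1 * A n).
    apply: le_trans (big n mn) _.
    apply: le_trans (_ : expect p n (fun x =>
       L * (avoidR m x * ((moves x)%:R / n.+2%:R / (1 + rescaled n x) ^+ 3)) +
       (eps * (n.+2%:R / (moves x)%:R) +
        a^-1 * (avoidR m x * rescaled n x))) <= _); last first.
      rewrite !expect_lin [X in _ + (_ + X) <= _]expectZ// lerD2l lerD2r ler_pM2l//.
      exact: expect_inverse_density.
    apply: expect_le => // x hx.
    have [N2 k2 kN _] := history_bounds (R := R) hx.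
    have l0 := rescaled_ge0 n x.
    have N0 : 0 < n.+2%:R :> R by [].
    have k0 : 0 < (moves x)%:R :> R by lra.
    set T1 := (moves x)%:R / n.+2%:R / (1 + rescaled n x) ^+ 3.
    have T10 : 0 <= T1 by rewrite !divr_ge0// exprn_ge0//; lra.
    have T20 : 0 <= eps * (n.+2%:R / (moves x)%:R) by rewrite mulr_ge0 ?divr_ge0// ltW.
    have T30 : 0 <= a^-1 * rescaled n x by rewrite mulr_ge0 ?invr_ge0// ltW.
    case: (boolP (avoids m.+2 x)) => avx; last first.
      rewrite /avoidR (negbTE avx) !mul0r !mulr0 add0r addr0; exact: T20.
    rewrite /avoidR avx !mul1r.
    (* the density is small, or M is large, or the loss is bounded below *)
    suff : [\/ 1 <= L * T1, 1 <= eps * (n.+2%:R / (moves x)%:R) | 1 <= a^-1 * rescaled n x].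
      have T10' : 0 <= L * T1 by rewrite mulr_ge0// ltW.
      case=> h; apply: (le_trans h).
      - by rewrite lerDl addr_ge0.
      - by rewrite addrCA lerDl addr_ge0.
      - by rewrite addrA lerDr addr_ge0.
    have [ha|ha] := lerP a (rescaled n x).
      by apply: Or33; rewrite mulrC ler_pdivlMr// mul1r.
    have [hk|hk] := lerP (moves x)%:R (eps * n.+2%:R).
      by apply: Or32; rewrite mulrA ler_pdivlMr// mul1r.
    apply: Or31; rewrite /L /T1.
    have hk' : eps <= (moves x)%:R / n.+2%:R by rewrite ler_pdivlMr// ltW.
    have L1 : (1 + a) ^+ 3 / eps * (eps / (1 + a) ^+ 3) = 1.
      by field; rewrite !gt_eqF//; lra.
    rewrite -[leLHS]L1 ler_pM2l// ler_pM ?invr_ge0 ?exprn_ge0//; try lra.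
    rewrite lef_pV2 ?posrE ?exprn_gt0//; try lra.
    by rewrite lerXn2r ?nnegrE//; lra.
  have : a^-1 * A n <= d / 4.
    by apply: le_trans a_A; rewrite mulrC ler_pM2r ?invr_gt0// A_le.
  rewrite /eps => h1 h2; lra.
have dL0 : 0 < d / 2 / L by rewrite divr_gt0// divr_gt0.
apply: (@harmonic_descent_false R B (e ^+ 2 * (d / 2 / L)) m).
- by rewrite mulr_gt0// exprn_gt0.
- move=> n; apply: expect_ge0 => // x _.
  by rewrite mulr_ge0// divr_ge0 ?addr_ge0 ?rescaled_ge0.
move=> n mn; apply: le_trans (B_le n mn) _.
by rewrite lerD2l lerN2 [leLHS]mulrAC ler_pM2l ?D_ge// divr_gt0// exprn_gt0.
Qed.

End Recurrence.

(** * Transience estimates *)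

Section Transience.
Context {R : realType} {p : R}.
Hypotheses (p1 : p < 1) (p11 : 11 / 16 < p).

Let beta : R := 2 * p - 1.
Let c : R := 1 + 6 / (2 * beta - 3 / 4).
Let p01 : 0 <= p <= 1. Proof. by have := p1; have := p11; lra. Qed.
Let gamma_gt0 : 0 < 2 * beta - 3 / 4.
Proof. by have := p11; rewrite /beta; lra. Qed.
Let c1 : 1 <= c. Proof. by rewrite /c lerDl divr_ge0// ltW. Qed.
Let c6 : 6 <= c * (2 * beta - 3 / 4).
Proof.
rewrite /c mulrDl mul1r divfK ?gt_eqF//; have := gamma_gt0; lra.
Qed.

(** The function [V = 1 / (c + w)] at time [n.+2]. *)
Definition closeness n (x : seq int) : R :=
  (c + spread n.+2%:R `|(displacement x)%:~R| (moves x)%:R)^-1.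

(** The added term pays for the errors [22 / N ^ 2] of [transient_drift] at all
times [N >= n.+2]. *)
Definition potential n (x : seq int) : R := closeness n x + 22 / n.+1%:R.

Lemma closeness_ge0 n x : 0 <= closeness n x.
Proof. by rewrite invr_ge0 addr_ge0 ?spread_ge0// (le_trans _ c1). Qed.

Lemma closeness_le1 n x : closeness n x <= 1.
Proof.
have h : 1 <= c + spread n.+2%:R `|(displacement x)%:~R| (moves x)%:R.
  by rewrite ler_wpDr ?spread_ge0.
by rewrite invf_le1// (lt_le_trans _ h).
Qed.

Lemma potential_ge0 n x : 0 <= potential n x.
Proof. by rewrite addr_ge0 ?closeness_ge0// divr_ge0. Qed.

Lemma potential_origin n x : displacement x = 0 -> c^-1 <= potential n x.
Proof.
move=> dx; rewrite /potential /closeness /spread dx normr0 expr0n mul0r addr0.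
by rewrite lerDl divr_ge0.
Qed.

Lemma potential_transition n x : history n x ->
  transition p n.+2 x (potential n.+1) <=
  potential n x - 1 / 20 / n.+2%:R * ((moves x)%:R / n.+2%:R * closeness n x ^+ 2).
Proof.
move=> hx; have [N2 k2 kN sk] := history_bounds (R := R) hx.
have k0 : 0 <= (moves x)%:R :> R by [].
have b1 : beta <= 1 by rewrite /beta; have := p1; lra.
have sk' : `| `|(displacement x)%:~R| | <= (moves x)%:R :> R by rewrite normr_id.
have := transient_drift b1 N2 k0 kN sk' c1 c6.
have := transition_sym (p := p) (fun s k => (c + spread n.+3%:R s k)^-1 + 22 / n.+2%:R) hx.
rewrite /= -/beta => tr dr.
apply: (@le_trans _ _ (transition p n.+2 x (fun y =>
  (c + spread n.+3%:R `|(displacement y)%:~R| (moves y)%:R)^-1 + 22 / n.+2%:R))) => //.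
rewrite tr -[n.+3%:R]natr1.
have -> : spread (n.+2%:R + 1) `| `|(displacement x)%:~R| - 1| ((moves x)%:R + 1) =
   spread (n.+2%:R + 1) (`|(displacement x)%:~R| - 1) ((moves x)%:R + 1) :> R.
  by rewrite /spread real_normK ?num_real.
rewrite /potential -/(closeness n x).
rewrite -/(closeness n x) in dr.
have h22 : 22 / n.+2%:R ^+ 2 + 22 / n.+2%:R <= 22 / n.+1%:R :> R.
  have n1 : 1 <= n.+1%:R :> R by rewrite ler1n.
  rewrite -[n.+2%:R]natr1; move: (n.+1%:R) n1 => z z1.
  rewrite -subr_ge0; set dd := (X in 0 <= X).
  have -> : dd = 22 / (z * (z + 1) ^+ 2) by rewrite /dd; field; lra.
  by rewrite divr_ge0 ?mulr_ge0 ?sqr_ge0//; lra.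
have e20 : (moves x)%:R / n.+2%:R / (20 * n.+2%:R) * closeness n x ^+ 2 =
  1 / 20 / n.+2%:R * ((moves x)%:R / n.+2%:R * closeness n x ^+ 2) :> R.
  have N0 : n.+2%:R != 0 :> R by [].
  by move: (n.+2%:R) N0 => z z0; field.
rewrite -e20.
move: dr h22; set u := up_prob _ _ _ _; set v := up_prob _ _ _ _.
set a1 := _^-1; set a2 := (_ + _)^-1; set a3 := (_ + _)^-1.
set q := _ * closeness n x ^+ 2; set i2 := 22 / _ ^+ 2; set i := 22 / n.+2%:R.
set j := 22 / _.
lra.
Qed.

Let avoidR m x : R := (avoids m.+2 x)%:R.

(** Maximal inequality for the supermartingale [potential], which is at least
[c^-1] at the origin. *)
Lemma hit_le_potential m n : (m <= n)%N ->
  expect p n (fun x => 1 - avoidR m x) <= c * expect p m (potential m).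
Proof.
move=> mn; have c0 : 0 < c by rewrite (lt_le_trans _ c1).
(* the potential stopped at the first visit, where it is lowered to 1 / c *)
pose W k x := (1 - avoidR m x) / c + avoidR m x * potential k x.
have W_start : expect p m (W m) <= expect p m (potential m).
  apply: expect_le => // x /and3P[/eqP sx _ _]; rewrite /W /avoidR -sx avoids_start.
  case: eqP => [/potential_origin h|_] /=; last by rewrite subrr mul0r add0r mul1r.
  by rewrite subr0 mul1r mul0r addr0.
have W_step k : (m <= k)%N -> expect p k.+1 (W k.+1) <= expect p k (W k).
  move=> mk; rewrite [leLHS]/=; apply: expect_le => // x hx.
  have /and3P[/eqP sx _ _] := hx.
  have av y : avoids m.+2 (rcons x y) =
      avoids m.+2 x && (displacement (rcons x y) != 0).
    by rewrite avoids_rcons// sx; lia.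
  case: (boolP (avoids m.+2 x)) => avx; last first.
    rewrite -[leRHS](transition_cst (p := p) _ hx); apply: transition_le => // y _.
    by rewrite /W /avoidR av (negbTE avx) !mul0r.
  apply: le_trans (_ : potential k x <= _); last first.
    by rewrite /W /avoidR avx subrr mul0r add0r mul1r.
  apply: le_trans (_ : transition p k.+2 x (potential k.+1) <= _).
    apply: transition_le => // y _; rewrite /W /avoidR av avx /=.
    case: eqP => [/potential_origin h|_] /=; last by rewrite subrr mul0r add0r mul1r.
    by rewrite subr0 mul1r mul0r addr0.
  apply: le_trans (potential_transition hx) _; rewrite gerBl.
  apply: mulr_ge0; first by rewrite divr_ge0// divr_ge0.
  exact: mulr_ge0 (divr_ge0 _ _) (sqr_ge0 _).
have W_le k : (m <= k)%N -> expect p k (W k) <= expect p m (potential m).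
  elim: k => [|k ih]; first by rewrite leqn0 => /eqP <-.
  rewrite leq_eqVlt => /orP[/eqP <- //|]; rewrite ltnS => mk.
  exact: le_trans (W_step _ mk) (ih mk).
rewrite mulrC -ler_pdivrMr// mulrC -expectZ//; apply: le_trans (W_le n mn).
apply: expect_le => // x _; rewrite /W mulrC lerDl.
by rewrite mulr_ge0// potential_ge0.
Qed.

(** Otherwise the expectation of [V] would stay away from [0]; as [n / k] is
bounded in mean, so would that of [(k / n) * V ^ 2], which bounds the decrease of
the potential from below up to the factor [1 / (20 * n)]. *)
Lemma potential_small (d : R) : 0 < d -> exists n, expect p n (potential n) < d.
Proof.
move=> d0; apply: contrapT => hex.
have big n : d <= expect p n (potential n).
  by rewrite leNgt; apply/negP => lt; apply: hex; exists n.
pose D n := expect p n (fun x => (moves x)%:R / n.+2%:R * closeness n x ^+ 2).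
have step n : expect p n.+1 (potential n.+1) <=
    expect p n (potential n) - 1 / 20 / n.+2%:R * D n.
  rewrite /D -mulNr -expectZ// -expectD// [leLHS]/=; apply: expect_le => // x hx.
  by apply: le_trans (potential_transition hx) _; rewrite mulNr.
pose eta := d / 4; pose eps := d ^+ 2 / 48.
have eta0 : 0 < eta by rewrite divr_gt0.
have eps0 : 0 < eps by rewrite divr_gt0// exprn_gt0.
have pot_le n : expect p n (potential n) <=
    eta + eta^-1 * (eps^-1 * D n + eps * 3) + 22 / n.+1%:R.
  apply: le_trans (_ : expect p n (fun x => (eta + eta^-1 *
      (eps^-1 * ((moves x)%:R / n.+2%:R * closeness n x ^+ 2) +
       eps * (n.+2%:R / (moves x)%:R))) + 22 / n.+1%:R) <= _); last first.
    rewrite !expectD// !expect_cst// lerD2r lerD2l (expectZ _ _ eta^-1)// ler_pM2l ?invr_gt0//.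
    rewrite expect_lin lerD2l (expectZ _ _ eps)// ler_pM2l//.
    exact: expect_inverse_density.
  apply: expect_le => // x hx; rewrite /potential lerD2r.
  have [N2 k2 kN _] := history_bounds (R := R) hx.
  have N0 : 0 < n.+2%:R :> R by [].
  have k0 : 0 < (moves x)%:R :> R by lra.
  have V0 := closeness_ge0 n x; have V1 := closeness_le1 n x.
  set V := closeness n x in V0 V1 *.
  (* the loss controls V only through its square *)
  have V_sqr : V <= eta + eta^-1 * V ^+ 2.
    rewrite -subr_ge0 (_ : _ - V = ((eta - V / 2) ^+ 2 + 3 / 4 * V ^+ 2) / eta).
      by rewrite divr_ge0 ?(ltW eta0)// addr_ge0 ?sqr_ge0// mulr_ge0 ?sqr_ge0.
    by field; rewrite gt_eqF.
  apply: (le_trans V_sqr); rewrite lerD2l ler_pM2l ?invr_gt0//.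
  have T0 : 0 <= eps^-1 * ((moves x)%:R / n.+2%:R * V ^+ 2).
    by apply: mulr_ge0 (mulr_ge0 (divr_ge0 _ _) (sqr_ge0 _)); rewrite ?invr_ge0 ltW.
  have [hk|hk] := lerP (moves x)%:R (eps * n.+2%:R).
    apply: (@le_trans _ _ 1); first by rewrite expr_le1.
    by rewrite ler_wpDl// mulrA ler_pdivlMr// mul1r.
  have T1 : 0 <= eps * (n.+2%:R / (moves x)%:R).
    exact: mulr_ge0 (ltW eps0) (divr_ge0 _ _).
  rewrite ler_wpDr//.
  rewrite mulrA ler_peMl ?sqr_ge0// mulrC ler_pdivlMr// mul1r.
  by rewrite ler_pdivlMr// ltW.
pose m := Num.truncn (88 / d).
have small n : (m <= n)%N -> 22 / n.+1%:R <= d / 4.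
  move=> mn; rewrite ler_pdivrMr// mulrAC ler_pdivlMr//.
  have : 88 / d < n.+1%:R.
    by apply: lt_le_trans (truncnS_gt _) _; rewrite ler_nat ltnS.
  rewrite ltr_pdivrMr//; lra.
have D_ge n : (m <= n)%N -> eps * eta * (d / 4) <= D n.
  move=> mn; have := le_trans (big n) (pot_le n); have := small n mn.
  have -> : eta^-1 * (eps^-1 * D n + eps * 3) = (eps * eta)^-1 * D n + d / 4.
    by rewrite /eps /eta; field; rewrite gt_eqF.
  have etaE : eta = d / 4 by [].
  move=> h1 h2; have : d / 4 <= (eps * eta)^-1 * D n.
    by move: etaE h1 h2; set X := _^-1 * D n; set Y := 22 / _; clearbody X Y eta; lra.
  by rewrite ler_pdivlMl ?mulr_gt0.
apply: (@harmonic_descent_false R (fun n => expect p n (potential n))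
  (1 / 20 * (eps * eta * (d / 4))) m).
- by rewrite !mulr_gt0.
- by move=> n; apply: expect_ge0 => // x _; exact: potential_ge0.
move=> n mn; apply: le_trans (step n) _; rewrite lerD2l lerN2 [leLHS]mulrAC.
by rewrite ler_pM2l ?D_ge// divr_gt0.
Qed.

Lemma transient_avoids (d : R) : 0 < d ->
  exists m, forall n, (m <= n)%N -> expect p n (fun x => 1 - avoidR m x) <= d.
Proof.
move=> d0; have c0 : 0 < c by rewrite (lt_le_trans _ c1).
have [m hm] := potential_small (divr_gt0 d0 c0).
exists m => n mn; apply: le_trans (hit_le_potential mn) _.
by rewrite mulrC -ler_pdivlMr// ltW.
Qed.

End Transience.

(** * The law of the walk *)

Lemma transition_sum (R : realFieldType) (p : R) n x (f : seq int -> R) :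
  transition p n x f = \sum_(i : ('I_n * bool) * ('I_n * bool))
    n%:R^-1 * (if i.1.2 then p else 1 - p) *
    (n%:R^-1 * (if i.2.2 then p else 1 - p)) *
    f (rcons x (sgz (sign_of i.1.2 * x`_i.1.1 + sign_of i.2.2 * x`_i.2.1))).
Proof.
rewrite /transition /channel pair_big /= -(pair_bigA _ (fun i j : 'I_n * bool =>
  n%:R^-1 * (if i.2 then p else 1 - p) * (n%:R^-1 * (if j.2 then p else 1 - p)) *
  f (rcons x (sgz (sign_of i.2 * x`_i.1 + sign_of j.2 * x`_j.1))))) /=.
apply: eq_bigr => i _; rewrite pair_big mulr_sumr /=; apply: eq_bigr => j _.
by rewrite !mulrA.
Qed.

Lemma expect_sum (R : realFieldType) (p : R) (n : nat) (I : Type) (r : seq I)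
    (a : I -> R) (f : I -> seq int -> R) : 0 <= p <= 1 ->
  expect p n (fun x => \sum_(i <- r) a i * f i x) =
  \sum_(i <- r) a i * expect p n (f i).
Proof.
move=> p01; elim: r => [|i r ih].
  rewrite big_nil -[RHS](expect_cst p01 n); apply: expect_eq => // x _.
  by rewrite big_nil.
rewrite big_cons -ih -expect_lin; apply: expect_eq => // x _.
by rewrite big_cons.
Qed.

Lemma sgz_is_step (R : realDomainType) (r : R) : is_step (sgz r).
Proof. by case: sgzP. Qed.

Section Law.
Local Open Scope classical_set_scope.

(** The sets [D i] need not cover the space; the condition on the sum says that
they do up to a null set, such as the event that an index falls out of range. *)
Lemma probability_partition (R : realType) (d : measure_display)
    (T : measurableType d) (P : probability T R) (I : finType)
    (D : I -> set T) (B : set T) :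
  (forall i, measurable (D i)) -> measurable B ->
  (forall i j, D i `&` D j !=set0 -> i = j) ->
  (\sum_i P (D i) = 1)%E -> (P B = \sum_i P (B `&` D i))%E.
Proof.
move=> mD mB disj sum1.
have union (F : I -> set T) : (forall i, measurable (F i)) ->
    (forall i j, F i `&` F j !=set0 -> i = j) ->
    P (\bigcup_i F i) = (\sum_i P (F i))%E.
  move=> mF dF; have finI : finite_set [set: I] by [].
  rewrite (measure_fin_bigcup P finI)//; last by move=> i j _ _; exact: dF.
  have -> : [set: I] = [set` index_enum I].
    by apply/seteqP; split => // i _; rewrite /= mem_index_enum.
  by rewrite -fsbig_seq// index_enum_uniq.
have mU : measurable (\bigcup_i D i) by apply: fin_bigcup_measurable.
have PU : P (~` (\bigcup_i D i)) = 0%E.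
  by rewrite probability_setC// (union D mD disj) sum1 subee.
rewrite -(union (fun i => B `&` D i)); last 2 first.
- by move=> i; exact: measurableI.
- by move=> i j [w [[_ Di] [_ Dj]]]; apply: disj; exists w.
have P0 : P (B `\` \bigcup_i D i) = 0%E.
  apply/eqP; rewrite eq_le measure_ge0 andbT -PU setDE.
  apply: le_measure; rewrite ?inE; [|exact: measurableC|exact: subIsetr].
  by apply: measurableI => //; exact: measurableC.
rewrite -setI_bigcupr [LHS](measureDI P mB mU) [X in (X + _)%E]P0 add0e.
by [].
Qed.

Context {R : realType} {d : measure_display} {T : measurableType d}
  {P : probability T R} {p : R} {X : nat -> {RV P >-> R}}
  {U : 'I_2 -> nat -> {RV P >-> nat}} {sigma : 'I_2 -> nat -> {RV P >-> R}}.

(** Taking signs makes every step an integer, even on the null set where an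
initial step is not [1] or [-1], so that any predicate of a trajectory defines a
measurable event. *)
Definition trajectory n (w : T) : seq int := [seq sgz (X j w) | j <- iota 1 n].

Lemma trajectoryS n w : trajectory n.+1 w = rcons (trajectory n w) (sgz (X n.+1 w)).
Proof. by rewrite /trajectory -[n.+1 in LHS]addn1 iotaD map_cat /= add1n cats1. Qed.

Lemma size_trajectory n w : size (trajectory n w) = n.
Proof. by rewrite size_map size_iota. Qed.

Lemma nth_trajectory n w j : (j < n)%N -> (trajectory n w)`_j = sgz (X j.+1 w).
Proof. by move=> jn; rewrite (nth_map 0%N) ?size_iota// nth_iota// add1n. Qed.

Lemma measurable_trajectory n (phi : pred (seq int)) :
  measurable [set w | phi (trajectory n w)].
Proof.
elim: n phi => [|n ih] phi.
  have [h|h] := boolP (phi [::]).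
    by rewrite (_ : [set _ | _] = setT)//; apply/seteqP; split.
  by rewrite (_ : [set _ | _] = set0)//; apply/seteqP; split => // w /= /(negP h).
have m_sgz y : measurable [set w | sgz (X n.+1 w) = y].
  have [mp mn m0] : [/\ measurable [set r : R | 0 < r],
      measurable [set r : R | r < 0] & measurable [set r : R | r = 0]].
    split.
    - by rewrite (_ : [set _ | _] = `]0, +oo[); [exact: measurable_itv|rewrite set_itvoy].
    - by rewrite (_ : [set _ | _] = `]-oo, 0[); [exact: measurable_itv|rewrite set_itvNyo].
    - exact: measurable_set1.
  have [->|y1] := eqVneq y 1.
    rewrite (_ : [set _ | _] = X n.+1 @^-1` [set r : R | 0 < r]).
      exact: measurable_funPTI.
    by apply/seteqP; split => w /=; [move/eqP|move=> h; apply/eqP]; rewrite sgz_cp0.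
  have [->|y2] := eqVneq y (-1).
    rewrite (_ : [set _ | _] = X n.+1 @^-1` [set r : R | r < 0]).
      exact: measurable_funPTI.
    by apply/seteqP; split => w /=; [move/eqP|move=> h; apply/eqP]; rewrite sgz_cp0.
  have [->|y3] := eqVneq y 0.
    rewrite (_ : [set _ | _] = X n.+1 @^-1` [set r : R | r = 0]).
      exact: measurable_funPTI.
    apply/seteqP; split => w /=; last by move=> ->; rewrite sgz0.
    by move/eqP; rewrite sgz_cp0 => /eqP.
  rewrite (_ : [set _ | _] = set0)//; apply/seteqP; split => // w /= /esym yE.
  by move: y1 y2 y3; rewrite yE; case: sgzP.
rewrite (_ : [set _ | _] = \bigcup_(y in [set` [:: 1; -1; 0 : int]])
    ([set w | sgz (X n.+1 w) = y] `&` [set w | phi (rcons (trajectory n w) y)])).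
  apply: fin_bigcup_measurable => // y _; apply: measurableI; first exact: m_sgz.
  exact: (ih (fun x => phi (rcons x y))).
apply/seteqP; split => w /=; rewrite trajectoryS.
  move=> h; exists (sgz (X n.+1 w)) => //; exact: sgz_is_step.
by move=> [y _ [/= -> h]].
Qed.

Definition proper_start (w : T) : Prop := forall j, (1 <= j <= 2)%N -> X j w = 1 \/ X j w = -1.

Hypothesis hX : two_channel_erw p X U sigma.

Lemma proper_start_step w j : proper_start w -> (0 < j)%N -> X j w = (sgz (X j w))%:~R.
Proof.
move=> sw j0; case: (leqP j 2) => j2.
  by have [|->|->] := sw j; rewrite ?j0 ?sgz1 ?sgzN1 //.
case: j j0 j2 => // j _ j2.
by rewrite {1}(erw_step hX)// sgrEz (erw_step hX w (n := j))// sgz_sgr.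
Qed.

Lemma position_trajectory w n k : proper_start w -> (k <= n)%N ->
  position X k w = (displacement (take k (trajectory n w)))%:~R.
Proof.
move=> sw kn; rewrite /position /displacement /trajectory -map_take take_iota (minn_idPl kn).
rewrite big_map rmorph_sum /= /index_iota subn1 /=.
apply: eq_big_seq => j; rewrite mem_iota => /andP[j1 _]; exact: proper_start_step.
Qed.

Lemma measurable_proper_start : measurable (proper_start : set T).
Proof.
rewrite (_ : (proper_start : set T) = \bigcap_(j in [set` [:: 1%N; 2%N]])
   (X j @^-1` [set 1] `|` X j @^-1` [set -1])).
  by apply: fin_bigcap_measurable => // j _; apply: measurableU; exact: measurable_funPTI.
apply/seteqP; split => w sw j.
  by rewrite /= !inE => /orP[] /eqP -> /=; exact: sw.
by move=> /andP[j1 j2]; apply: sw => /=; rewrite !inE; lia.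
Qed.

(** The sources of time at most [n] determine the first [n] steps; the two initial
steps count as one source of time [2] each. *)
Definition source_time (l : source) : nat :=
  match l with inl _ => 2%N | inr (inl (_, m)) => m | inr (inr (_, m)) => m end.

Let algebra := source_algebra X U sigma.

Lemma source_algebra_measurable l A : algebra l A -> measurable A.
Proof.
case: l => [j|[[i m]|[i m]]] [B mB <-]; rewrite setTI; exact: measurable_funPTI.
Qed.

Lemma independent_fine (s : seq source) (E : source -> set T) : uniq s ->
  (forall l, l \in s -> active l /\ algebra l (E l)) ->
  P (\bigcap_(l in [set` s]) E l) = (\prod_(l <- s) fine (P (E l)))%:E.
Proof.
move=> us hs; rewrite (erw_independent hX us hs) -prodEFin.
apply: eq_big_seq => l /hs[_ /source_algebra_measurable mE].
by rewrite fineK// fin_num_measure.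
Qed.

Lemma sign_of_inj : injective (fun e => (sign_of e)%:~R : R).
Proof. by move=> [] [] //= /intr_inj. Qed.

Lemma trajectory_law_start (phi : pred (seq int)) (s : seq source)
    (E : source -> set T) : uniq s ->
  (forall l, l \in s -> [/\ active l, algebra l (E l) & (2 < source_time l)%N]) ->
  P ((proper_start : set T) `&` [set w | phi (trajectory 2 w)] `&`
     \bigcap_(l in [set` s]) E l) =
  (expect p 0 (fun x => (phi x)%:R) * \prod_(l <- s) fine (P (E l)))%:E.
Proof.
move=> us hs; pose lab : seq source := [:: inl 1%N; inl 2%N].
pose E' (i : bool * bool) (l : source) : set T :=
  if l is inl j
  then X j @^-1` [set (sign_of (if (j == 1)%N then i.1 else i.2))%:~R] else E l.
have E's i l : l \in s -> E' i l = E l by case: l => // j /hs[].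
have memL l : l \in lab -> l \in lab ++ s by rewrite mem_cat => ->.
have memR l : l \in s -> l \in lab ++ s by rewrite mem_cat orbC => ->.
have us' : uniq (lab ++ s).
  rewrite cat_uniq us andbT /=; apply/hasPn => l /hs[_ _]; apply: contraTN.
  by rewrite !inE => /orP[] /eqP ->.
have algE' i l : l \in lab -> active l /\ algebra l (E' i l).
  by rewrite !inE => /orP[] /eqP ->; split=> //; (eexists; last exact: setTI);
    exact: measurable_set1.
have hs' i l : l \in lab ++ s -> active l /\ algebra l (E' i l).
  rewrite mem_cat => /orP[/algE'|hl]; first exact.
  by have [al gl _] := hs l hl; rewrite E's.
have PX j e : (1 <= j <= 2)%N -> P (X j @^-1` [set (sign_of e)%:~R]) = (2^-1)%:E.
  by move=> /(erw_initial hX)[]; case: e; rewrite /sign_of ?mulr1z ?mulrN1z.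
have PE' i : \prod_(l <- lab) fine (P (E' i l)) = 4^-1.
  by rewrite !big_cons big_nil /E' /= !PX//=; field.
pose D i := \bigcap_(l in [set` lab]) E' i l.
have PD i : P (D i) = (4^-1)%:E by rewrite /D independent_fine ?PE'//; exact: algE'.
have DP i w : D i w -> X 1%N w = (sign_of i.1)%:~R /\ X 2%N w = (sign_of i.2)%:~R.
  by move=> Dw; split; [apply: (Dw (inl 1%N))|apply: (Dw (inl 2%N))].
have mD i : measurable (D i).
  apply: fin_bigcap_measurable => // l /= hl.
  by have [_ /source_algebra_measurable] := algE' i l hl.
have dD i j : D i `&` D j !=set0 -> i = j.
  move=> [w [/DP[i1 i2] /DP[]]]; rewrite i1 i2 => /sign_of_inj e1 /sign_of_inj e2.
  by rewrite (surjective_pairing i) e1 e2 -surjective_pairing.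
have sD : (\sum_i P (D i) = 1)%E.
  rewrite (eq_bigr (fun=> (4^-1)%:E)) => [|i _]; last exact: PD.
  rewrite sumEFin sumr_const card_prod card_bool; congr EFin.
  by rewrite -[_ *+ _]mulr_natr mulVf.
set B := (_ `&` _).
have mB : measurable B.
  apply: measurableI.
    by apply: measurableI; [exact: measurable_proper_start|exact: measurable_trajectory].
  by apply: fin_bigcap_measurable => // l /= /hs[_ gl _];
    exact: source_algebra_measurable gl.
rewrite (probability_partition mD mB dD sD).
have PBD i : P (B `&` D i) =
    (4^-1 * (phi [:: sign_of i.1; sign_of i.2])%:R * \prod_(l <- s) fine (P (E l)))%:E.
  have sgz_sign e : sgz ((sign_of e)%:~R : R) = sign_of e by rewrite sgz_int; case: e.
  have path2 w : D i w -> trajectory 2 w = [:: sign_of i.1; sign_of i.2].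
    by move=> /DP[i1 i2]; rewrite /trajectory /= i1 i2 !sgz_sign.
  case: (boolP (phi _)) => hphi; last first.
    rewrite mulr0 mul0r (_ : _ `&` _ = set0) ?measure0//.
    apply/seteqP; split => // w [[[_ /= phiw] _] Dw].
    by move: hphi; rewrite -(path2 w)// phiw.
  rewrite (_ : _ `&` _ = \bigcap_(l in [set` lab ++ s]) E' i l).
    rewrite independent_fine//; last exact: hs'.
    rewrite big_cat /= PE' mulr1; congr (_ * _)%:E.
    by apply: eq_big_seq => l hl; rewrite E's.
  apply/seteqP; split => w.
    move=> [[_ Ew] Dw] l hl; move: (hl : l \in lab ++ s); rewrite mem_cat => {hl} /orP[hl|hl].
      exact: Dw.
    by rewrite E's//; exact: Ew.
  move=> hw; have Dw : D i w.
    by move=> l hl; exact: hw (memL _ hl).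
  have [i1 i2] := DP i w Dw; split=> //; split; first split.
  - move=> [|[|[|j]]]// _; rewrite ?i1 ?i2 /sign_of.
      by case: ifP; rewrite ?mulr1z ?mulrN1z; [left|right].
    by case: ifP; rewrite ?mulr1z ?mulrN1z; [left|right].
  - by rewrite /= path2.
  - by move=> l hl; rewrite -(E's i)//; exact: hw (memR _ hl).
rewrite (eq_bigr _ (fun i _ => PBD i)) sumEFin; congr EFin.
by rewrite -mulr_suml /= pair_bigA.
Qed.

(** The events [E l] of the future sources are there for the induction: at each
step, the four sources of the current time are moved from the future to the past.
This replaces a proof that the past is independent of the future as a whole, for
which the independence of single sources would have to be extended to the
sigma-algebras that they generate together. *)
Lemma trajectory_law (hp : 0 <= p <= 1) n (phi : pred (seq int)) (s : seq source)
    (E : source -> set T) : uniq s ->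
  (forall l, l \in s -> [/\ active l, algebra l (E l) & (n.+2 < source_time l)%N]) ->
  P ((proper_start : set T) `&` [set w | phi (trajectory n.+2 w)] `&`
     \bigcap_(l in [set` s]) E l) =
  (expect p n (fun x => (phi x)%:R) * \prod_(l <- s) fine (P (E l)))%:E.
Proof.
elim: n phi s E => [|n ih] phi s E us hs; first exact: trajectory_law_start.
set N := n.+2; pose draw e : R := N%:R^-1 * (if e then p else 1 - p).
pose lab : seq source := [:: inr (inl (ord0, N.+1)); inr (inl (ord_max, N.+1));
  inr (inr (ord0, N.+1)); inr (inr (ord_max, N.+1))].
pose J : finType := (('I_N * bool) * ('I_N * bool))%type.
pose E' (i : J) (l : source) : set T :=
  if (source_time l == N.+1)%N then
    match l with
    | inl _ => setT
    | inr (inl (c, _)) =>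
        U c N.+1 @^-1` [set (if c == ord0 then i.1.1.+1 else i.2.1.+1)%N]
    | inr (inr (c, _)) =>
        sigma c N.+1 @^-1` [set (sign_of (if c == ord0 then i.1.2 else i.2.2))%:~R]
    end
  else E l.
have E's i l : l \in s -> E' i l = E l.
  by move=> /hs[_ _ lt]; rewrite /E' gtn_eqF.
have ulab : uniq lab by [].
have memL l : l \in lab -> l \in lab ++ s by rewrite mem_cat => ->.
have memR l : l \in s -> l \in lab ++ s by rewrite mem_cat orbC => ->.
have us' : uniq (lab ++ s).
  rewrite cat_uniq ulab us andbT /=; apply/hasPn => l /hs[_ _]; apply: contraTN.
  by rewrite !inE => /or4P[] /eqP ->; rewrite ltnn.
have algE' i l : l \in lab -> active l /\ algebra l (E' i l).
  by rewrite !inE => /or4P[] /eqP ->; split=> //; rewrite /E' /= eqxx;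
    (eexists; last exact: setTI); do ?exact: measurable_set1.
have hs' i l : l \in lab ++ s ->
    [/\ active l, algebra l (E' i l) & (n.+2 < source_time l)%N].
  rewrite mem_cat => /orP[hl|hl].
    have [al gl] := algE' i l hl; split=> //.
    by move: hl; rewrite !inE => /or4P[] /eqP ->.
  by have [al gl tl] := hs l hl; split; rewrite ?E's//; exact: ltnW.
have PE' i : \prod_(l <- lab) fine (P (E' i l)) = draw i.1.2 * draw i.2.2.
  have PU c (k : 'I_N) : P (U c N.+1 @^-1` [set k.+1]) = (N%:R^-1)%:E.
    by apply: (erw_index hX) => //=.
  have Ps c e : P (sigma c N.+1 @^-1` [set (sign_of e)%:~R]) =
      (if e then p else 1 - p)%:E.
    have [h1 h2] := erw_sign hX c (isT : 2 <= N)%N.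
    by case: e; rewrite /sign_of ?mulr1z ?mulrN1z.
  rewrite !big_cons big_nil /E' /= !eqxx /= !PU !Ps /= /draw; ring.
pose D i := \bigcap_(l in [set` lab]) E' i l.
have PD i : P (D i) = (draw i.1.2 * draw i.2.2)%:E.
  by rewrite /D (independent_fine ulab (algE' i)) PE'.
have DP i w : D i w ->
    [/\ U ord0 N.+1 w = i.1.1.+1, U ord_max N.+1 w = i.2.1.+1,
        sigma ord0 N.+1 w = (sign_of i.1.2)%:~R &
        sigma ord_max N.+1 w = (sign_of i.2.2)%:~R].
  move=> Dw; have Dl l : l \in lab -> E' i l w by exact: Dw.
  split.
  - by have := Dl (inr (inl (ord0, N.+1))); rewrite /E' /= eqxx !inE eqxx; exact.
  - by have := Dl (inr (inl (ord_max, N.+1))); rewrite /E' /= eqxx !inE eqxx; exact.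
  - by have := Dl (inr (inr (ord0, N.+1))); rewrite /E' /= eqxx !inE eqxx; exact.
  - by have := Dl (inr (inr (ord_max, N.+1))); rewrite /E' /= eqxx !inE eqxx; exact.
have mD i : measurable (D i).
  apply: fin_bigcap_measurable => // l /= hl.
  by have [_ /source_algebra_measurable] := algE' i l hl.
have dD i j : D i `&` D j !=set0 -> i = j.
  move=> [w [/DP[i1 i2 i3 i4] /DP[]]]; rewrite i1 i2 i3 i4.
  move: i j {i1 i2 i3 i4} => [[u1 e1] [u2 e2]] [[v1 f1] [v2 f2]] /=.
  by move=> /succn_inj/val_inj-> /succn_inj/val_inj-> /sign_of_inj-> /sign_of_inj->.
have sD : (\sum_i P (D i) = 1)%E.
  rewrite (eq_bigr (fun i : J => (draw i.1.2 * draw i.2.2)%:E)) => [|i _]; last exact: PD.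
  rewrite sumEFin; congr EFin.
  (* the draws do not depend on the history, so any one of them gives the total *)
  have hx : history n (nseq N 1) by rewrite /history size_nseq eqxx all_nseq /moves count_nseq.
  rewrite -(transition_cst (p := p) 1 hx) transition_sum.
  by apply: eq_bigr => i _; rewrite mulr1.
set B := (_ `&` _).
have mB : measurable B.
  apply: measurableI.
    by apply: measurableI; [exact: measurable_proper_start|exact: measurable_trajectory].
  by apply: fin_bigcap_measurable => // l /= /hs[_ gl _];
    exact: source_algebra_measurable gl.
rewrite (probability_partition mD mB dD sD).
(* on the event D i the next step is a function of the past *)
pose next (i : J) (x : seq int) := rcons x
  (sgz (sign_of i.1.2 * x`_i.1.1 + sign_of i.2.2 * x`_i.2.1)).
have path_next i w : proper_start w -> D i w -> trajectory N.+1 w = next i (trajectory N w).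
  move=> sw /DP[u1 u2 s1 s2]; rewrite trajectoryS /next !nth_trajectory//.
  rewrite (erw_step hX)// sgz_sgr big_ord_recl big_ord1.
  rewrite (_ : lift ord0 ord0 = ord_max); last exact: val_inj.
  rewrite u1 u2 s1 s2.
  rewrite [in LHS](proper_start_step sw (j := i.1.1.+1))//.
  rewrite [in LHS](proper_start_step sw (j := i.2.1.+1))//.
  by rewrite -!intrM -intrD sgz_int.
have PBD i : P (B `&` D i) = (draw i.1.2 * draw i.2.2 *
    expect p n (fun x => (phi (next i x))%:R) * \prod_(l <- s) fine (P (E l)))%:E.
  rewrite (_ : _ `&` _ = (proper_start : set T) `&`
      [set w | phi (next i (trajectory N w))] `&` \bigcap_(l in [set` lab ++ s]) E' i l).
    rewrite (ih (fun x => phi (next i x)) _ _ us' (hs' i)) big_cat /= PE'.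
    rewrite mulrA [X in (X * _)%:E]mulrC; congr (_ * _)%:E.
    by apply: eq_big_seq => l hl; rewrite E's.
  apply/seteqP; split => w.
    move=> [[[sw phiw] Ew] Dw]; split; first by split=> //; rewrite /= -path_next.
    move=> l hl; move: (hl : l \in lab ++ s); rewrite mem_cat => {hl} /orP[hl|hl].
      exact: Dw.
    by rewrite E's//; exact: Ew.
  move=> [[sw phiw] hw]; have Dw : D i w.
    by move=> l hl; exact: hw (memL _ hl).
  split=> //; split; first by split=> //; rewrite /= (path_next i).
  by move=> l hl; rewrite -(E's i)//; exact: hw (memR _ hl).
rewrite (eq_bigr _ (fun i _ => PBD i)) sumEFin -mulr_suml; congr (_ * _)%:E.
rewrite -expect_sum//=; apply: expect_eq => // x _.
by rewrite transition_sum.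
Qed.

Lemma trajectory_probability (hp : 0 <= p <= 1) n (phi : pred (seq int)) :
  P ((proper_start : set T) `&` [set w | phi (trajectory n.+2 w)]) =
  (expect p n (fun x => (phi x)%:R))%:E.
Proof.
have := @trajectory_law hp n phi [::] (fun=> setT) isT (fun _ => ltac:(done)).
by rewrite big_nil mulr1 set_nil bigcap_set0 setIT.
Qed.

End Law.

(** * Recurrence, transience and the main theorem *)

Section Dichotomy.
Local Open Scope classical_set_scope.

Lemma finite_natP (A : set nat) : finite_set A <-> exists m, forall n, A n -> (n < m)%N.
Proof.
split=> [/finite_seqP[s ->]|[m h]]; last exact: sub_finite_set h (finite_II m).
exists (\max_(i <- s) i)%N.+1 => n /= ns; rewrite ltnS.
exact: (@leq_bigmax_seq nat s xpredT id n ns isT).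
Qed.

Lemma probability_eq0 (R : realType) (d : measure_display)
    (T : measurableType d) (P : probability T R) (A : set T) : measurable A ->
  (forall e : R, 0 < e -> (P A <= e%:E)%E) -> P A = 0%E.
Proof.
move=> mA h; apply/eqP; rewrite eq_le measure_ge0 andbT.
by apply/lee_addgt0Pr => e e0; rewrite add0e; exact: h.
Qed.

Context {R : realType} {d : measure_display} {T : measurableType d}
  {P : probability T R} {p : R} {X : nat -> {RV P >-> R}}
  {U : 'I_2 -> nat -> {RV P >-> nat}} {sigma : 'I_2 -> nat -> {RV P >-> R}}.
Hypotheses (hp : 0 < p < 1) (hX : two_channel_erw p X U sigma).

Let p01 : 0 <= p <= 1. Proof. by case/andP: hp => h0 h1; rewrite !ltW. Qed.

Local Notation properX := (proper_start (X := X) : set T).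
Local Notation trajectoryX := (trajectory (X := X)).

Lemma avoids_trajectory w m n : properX w ->
  avoids m (trajectoryX n w) <-> forall j, (m <= j <= n)%N -> position X j w != 0.
Proof.
move=> sw; rewrite /avoids size_trajectory.
split=> [/allP h j /andP[mj jn]|h].
  have := h j; rewrite (position_trajectory hX sw jn) intr_eq0; apply.
  by rewrite mem_iota mj subnKC ?ltnS// (leq_trans mj)// leqW.
apply/allP => j; rewrite mem_iota => /andP[mj jn].
have jn' : (j <= n)%N by lia.
by have := h j; rewrite mj jn' (position_trajectory hX sw jn') intr_eq0; exact.
Qed.

Let measurable_event (phi : pred (seq int)) n :
  measurable (properX `&` [set w | phi (trajectoryX n w)]).
Proof.
by apply: measurableI; [exact: measurable_proper_start|exact: measurable_trajectory].
Qed.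

Lemma improper_start_negligible : P.-negligible (~` properX).
Proof.
have P1 : P properX = 1%E.
  have := trajectory_probability hX p01 0 predT; rewrite expect_cst// => <-.
  by congr (P _); apply/seteqP; split => // w [].
have P0 : P (~` properX) = 0%E.
  by rewrite (probability_setC P measurable_proper_start) P1 subee.
by apply/negligibleP => //; exact/measurableC/measurable_proper_start.
Qed.

(** A trajectory with finitely many zeros avoids the origin from some time on. *)
Lemma recurrent_le : p <= 11 / 16 -> recurrent X.
Proof.
move=> p11; pose N m := \bigcap_n (properX `&` [set w | avoids m.+2 (trajectoryX n.+2 w)]).
have mN m : measurable (N m).
  by apply: bigcap_measurableType => n _; exact: measurable_event.
have N0 m : P.-negligible (N m).
  apply/negligibleP => //; apply: probability_eq0 => // e e0.
  have /andP[p0 p1] := hp.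
  have [n _ /ltW hn] := recurrent_avoids p0 p1 m p11 e0.
  apply: le_trans (_ : (expect p n (fun x => (avoids m.+2 x)%:R))%:E <= _)%E; last first.
    by rewrite lee_fin.
  rewrite -(trajectory_probability hX p01); apply: le_measure; rewrite ?inE//.
  exact: bigcap_inf.
apply: negligibleS (negligibleU improper_start_negligible (negligible_bigcup N0)).
move=> w /= /contrapT /finite_natP[m hm].
have [sw|] := pselect (properX w); last by left.
right; exists m => // n _; split=> //=; apply/avoids_trajectory => // j /andP[mj _].
by apply/eqP => /hm; lia.
Qed.

(** A trajectory with infinitely many zeros visits the origin after every time
[m], and the probability of such a visit is arbitrarily small. *)
Lemma transient_gt : 11 / 16 < p -> transient X.
Proof.
move=> p11; have /andP[p0 p1] := hp.
pose Z m n := properX `&` [set w | ~~ avoids m.+2 (trajectoryX n.+2 w)].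
have mZ m n : measurable (Z m n).
  exact: (measurable_event (fun x => ~~ avoids m.+2 x)).
have mUZ m : measurable (\bigcup_n Z m n) by exact: bigcup_measurable.
have Z0 : P.-negligible (\bigcap_m \bigcup_n Z m n).
  apply/negligibleP; first by apply: bigcap_measurableType => m _.
  apply: probability_eq0 => [|e e0]; first by apply: bigcap_measurableType => m _.
  have [m hm] := transient_avoids p1 p11 e0.
  apply: le_trans (_ : P (\bigcup_n Z m n) <= _)%E.
    apply: le_measure; rewrite ?inE//; last exact: bigcap_inf.
    by apply: bigcap_measurableType => k _.
  have ndZ : nondecreasing_seq (Z m).
    move=> i j ij; apply/subsetPset => w [sw /= hw]; split=> //=.
    apply: contra hw => /(avoids_trajectory _ _ sw) hw; apply/(avoids_trajectory _ _ sw) => k.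
    by move=> mk; apply: hw; lia.
  have cv := nondecreasing_cvg_mu (mu := P) (mZ m) (mUZ m) ndZ.
  rewrite -(cvg_lim _ cv)//; apply: lime_le; first by apply/cvg_ex; eexists; exact: cv.
  exists m => // n /= mn.
  rewrite (trajectory_probability hX p01 n (fun x => ~~ avoids m.+2 x)) lee_fin.
  apply: le_trans (hm n mn); apply: expect_le => // x _.
  by case: (avoids _ _); rewrite ?subrr ?subr0.
apply: negligibleS (negligibleU improper_start_negligible Z0).
move=> w /= fin; have [sw|] := pselect (properX w); last by left.
right=> m _; apply: contrapT => hm; apply: fin; apply/finite_natP.
(* index n in the trajectories is time n.+2 *)
exists m.+2 => n; apply: contraPT; rewrite -leqNgt => mn; apply/eqP.
have : avoids m.+2 (trajectoryX n w).
  apply: contrapT => /negP h; apply: hm; exists n.-2 => //; split=> //=.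
  by rewrite (_ : n.-2.+2 = n)//; lia.
by move/(avoids_trajectory _ _ sw); apply; rewrite mn leqnn.
Qed.

Lemma recurrent_not_transient : recurrent X -> transient X -> False.
Proof.
move=> hr ht; have : (0 < P setT)%E by rewrite probability_setT lte01.
move=> /ae_properfilter_algebraOfSetsType ae_proper.
by have [w []] := filter_ex (@filterI _ _ (@filter_filter _ _ ae_proper) _ _ hr ht).
Qed.

End Dichotomy.

Theorem theorem1p1 (R : realType) (d : measure_display) (T : measurableType d)
    (P : probability T R) (p : R) (X : nat -> {RV P >-> R})
    (U : 'I_2 -> nat -> {RV P >-> nat}) (sigma : 'I_2 -> nat -> {RV P >-> R})
    (hp : 0 < p < 1) (hX : two_channel_erw p X U sigma) :
  (recurrent X <-> p <= 11%:R / 16%:R) /\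
  (transient X <-> 11%:R / 16%:R < p).
Proof.
split; split.
- move=> hr; rewrite leNgt; apply/negP => /(transient_gt hp hX).
  exact: recurrent_not_transient.
- exact: (recurrent_le hp hX).
- move=> ht; rewrite ltNge; apply/negP => /(recurrent_le hp hX) hr.
  exact: (recurrent_not_transient hr).
- exact: (transient_gt hp hX).
Qed.
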